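(* Let $d\ge1$ and let $\varphi_1,\varphi_2\in\mathcal{C}_0^\infty(\mathbb{R}^d)$ with $\varphi_1(0)=\varphi_2(0)=1$, $\varphi_1\ge0$, $\varphi_2\ge0$. Let $1\le q,r\le\infty$. Assume that either (i) for every $a\in L^q(\mathbb{R}^{2d})$ the operator $A_a^{\varphi_1,\varphi_2}$ is bounded on $L^r(\mathbb{R}^d)$; or (ii) there is a constant $C>0$ such that $$\|A_a^{\varphi_1,\varphi_2}f\|_{L^r}\le C\,\|a\|_{L^q}\,\|f\|_{L^r}\qquad\text{for all } f\in\mathcal{S}(\mathbb{R}^d),\ a\in\mathcal{S}(\mathbb{R}^{2d}).$$ Then $$\frac1q\ge\left|\frac1r-\frac12\right|.$$
   Context: $\mathcal{C}_0^\infty$ denotes smooth compactly supported functions and $\mathcal{S}$ the Schwartz class. STFT: $V_\varphi f(x,\omega)=\int_{\mathbb{R}^d} f(t)\,\overline{\varphi(t-x)}\,e^{-2\pi i\omega t}\,dt$, $(x,\omega)\in\mathbb{R}^{2d}$. Localization operator: with $T_xf(t)=f(t-x)$, $M_\omega f(t)=e^{2\pi i\omega t}f(t)$, the operator with symbol $a$ and windows $\varphi_1,\varphi_2$ is formally $A_a^{\varphi_1,\varphi_2}f(t)=\int_{\mathbb{R}^{2d}}a(x,\omega)V_{\varphi_1}f(x,\omega)M_\omega T_x\varphi_2(t)\,dx\,d\omega$. It is interpreted weakly: $\langle A_a^{\varphi_1,\varphi_2}f,g\rangle=\int_{\mathbb{R}^{2d}}a(x,\omega)\,V_{\varphi_1}f(x,\omega)\,\overline{V_{\varphi_2}g(x,\omega)}\,dx\,d\omega$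 for $f$ in the domain space and $g\in\mathcal{S}(\mathbb{R}^d)$ (the integral converges absolutely for the symbols, windows and functions considered here), where $\langle\cdot,\cdot\rangle$ extends the inner product $\langle f,g\rangle=\int f\bar g$ of $L^2$. *)

(* Defs.v *)
From HB Require Import structures.
From mathcomp Require Import all_boot all_order all_algebra.
From mathcomp Require Import all_classical all_reals all_analysis.
From mathcomp Require Import complex.

Set Implicit Arguments.
Unset Strict Implicit.
Unset Printing Implicit Defensive.
Import Order.TTheory GRing.Theory Num.Theory.
Import numFieldNormedType.Exports.

Local Open Scope classical_set_scope.
Local Open Scope ring_scope.
Local Open Scope complex_scope.

Definition measure_rV_display : measure_display -> measure_display.
Proof. exact. Qed.

Section measurable_rV.
Context {d} {T : measurableType d} (n : nat).

Let coord (i : 'I_n) (x : 'rV[T]_n) : T := x ord0 i.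

Let rV_set0 : g_sigma_preimage coord set0.
Proof. exact: sigma_algebra0. Qed.

Let rV_setC A : g_sigma_preimage coord A -> g_sigma_preimage coord (~` A).
Proof. exact: sigma_algebraC. Qed.

Let rV_bigcup (F : (set 'rV[T]_n)^nat) :
  (forall i, g_sigma_preimage coord (F i)) ->
  g_sigma_preimage coord (\bigcup_i (F i)).
Proof. exact: sigma_algebra_bigcup. Qed.

(* The sigma-algebra generated by the coordinates: on 'rV[R]_n, the Borel sets. The
   L^p classes of Borel and of Lebesgue measurable functions are
   the same. *)
HB.instance Definition _ := @isMeasurable.Build (measure_rV_display d)
  'rV[T]_n (g_sigma_preimage coord) rV_set0 rV_setC rV_bigcup.

Lemma measurable_coord (i : 'I_n) :
  measurable_fun [set: 'rV[T]_n] (fun x : 'rV[T]_n => x ord0 i).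
Proof.
move=> _ Y mY; rewrite setTI; apply: sub_sigma_algebra => /=.
rewrite -bigcup_seq/=; exists i => /=; first by rewrite mem_index_enum.
by exists Y => //; rewrite setTI.
Qed.

Lemma measurable_fun_rVP d' (T' : measurableType d') (f : T' -> 'rV[T]_n) :
  (forall i, measurable_fun setT (fun x => f x ord0 i)) ->
  measurable_fun setT f.
Proof.
move=> mf; rewrite /measurable_fun => _ Y mY; rewrite setTI.
suff : <<s \big[setU/set0]_(i < n)
    preimage_set_system setT (coord i) measurable >> `<=`
    [set A | measurable (f @^-1` A)] by apply; exact: mY.
apply: smallest_sub.
  split=> /=.
  - by rewrite preimage_set0.
  - by move=> A mA; rewrite setTD preimage_setC; exact: measurableC.
  - by move=> F mF; rewrite preimage_bigcup; exact: bigcupT_measurable.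
rewrite -bigcup_seq/=; apply: bigcup_sub => i _ A [B mB <-] /=.
by rewrite setTI -[X in measurable X]setTI; exact: mf.
Qed.

End measurable_rV.

Section lebesgue_rV_step.
Context {R : realType} (n : nat) (mu : {sigma_finite_measure set 'rV[R]_n -> \bar R}).

(* Prepends a coordinate: identifies R * R^n with R^n.+1. *)
Definition cons_rV (p : measurableTypeR R * 'rV[R]_n) : 'rV[R]_n.+1 :=
  \row_i (if unlift ord0 i is Some j then p.2 ord0 j else p.1).

Definition uncons_rV (x : 'rV[R]_n.+1) : measurableTypeR R * 'rV[R]_n :=
  (x ord0 ord0, \row_i x ord0 (lift ord0 i)).

Lemma cons_rV0 p : cons_rV p ord0 ord0 = p.1.
Proof. by rewrite mxE unlift_none. Qed.

Lemma cons_rVS p i : cons_rV p ord0 (lift ord0 i) = p.2 ord0 i.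
Proof. by rewrite mxE liftK. Qed.

Lemma cons_rVK : cancel cons_rV uncons_rV.
Proof.
move=> [x y]; rewrite /uncons_rV cons_rV0/=; congr pair.
by apply/rowP => i; rewrite mxE cons_rVS.
Qed.

Lemma uncons_rVK : cancel uncons_rV cons_rV.
Proof.
move=> x; apply/rowP => i; case: (unliftP ord0 i) => [j|] ->.
  by rewrite cons_rVS/= mxE.
by rewrite cons_rV0.
Qed.

Lemma measurable_cons_rV : measurable_fun setT cons_rV.
Proof.
apply: measurable_fun_rVP => i; case: (unliftP ord0 i) => [j|] ->.
  under eq_fun do rewrite cons_rVS.
  exact: (measurableT_comp (measurable_coord j) measurable_snd).
under eq_fun do rewrite cons_rV0.
exact: measurable_fst.
Qed.

Lemma measurable_uncons_rV : measurable_fun setT uncons_rV.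
Proof.
apply/measurable_fun_pairP; split.
  exact: (measurable_coord (T := R) (ord0 : 'I_n.+1)).
apply: measurable_fun_rVP => i /=.
under eq_fun do rewrite mxE.
exact: (measurable_coord (T := R)).
Qed.

Definition lebesgue_cons : set 'rV[R]_n.+1 -> \bar R :=
  pushforward (@lebesgue_measure R \x mu)%E cons_rV.

HB.instance Definition _ := isMeasurableFun.Build _ _ _ _ cons_rV
  measurable_cons_rV.

Let lebesgue_cons0 : lebesgue_cons set0 = 0%E.
Proof. exact: measure0. Qed.

Let lebesgue_cons_ge0 A : (0 <= lebesgue_cons A)%E.
Proof. exact: measure_ge0. Qed.

Let lebesgue_cons_sigma_additive : semi_sigma_additive lebesgue_cons.
Proof. exact: measure_semi_sigma_additive. Qed.

HB.instance Definition _ := isMeasure.Build _ _ _ lebesgue_cons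
  lebesgue_cons0 lebesgue_cons_ge0 lebesgue_cons_sigma_additive.

Let lebesgue_cons_sigma_finite : sigma_finite setT lebesgue_cons.
Proof.
have /sigma_finiteP[F [TF ndF Foo]] := sigma_finiteT (@lebesgue_measure R).
have /sigma_finiteP[G [TG ndG Goo]] := sigma_finiteT mu.
exists (fun k => uncons_rV @^-1` (F k `*` G k)).
  apply/esym; rewrite -subTset => x _.
  have [i _ Fi] : (\bigcup_i F i) (uncons_rV x).1 by rewrite -TF.
  have [j _ Gj] : (\bigcup_j G j) (uncons_rV x).2 by rewrite -TG.
  exists (maxn i j) => //; split.
    by move: Fi; exact/subsetPset/ndF/leq_maxl.
  by move: Gj; exact/subsetPset/ndG/leq_maxr.
move=> k; have [mF Fk] := Foo k; have [mG Gk] := Goo k; split.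
  rewrite -[X in measurable X]setTI; apply: measurable_uncons_rV => //.
  exact: measurableX.
rewrite /lebesgue_cons /pushforward -comp_preimage.
rewrite (_ : _ \o _ = id); last exact/funext/cons_rVK.
by rewrite preimage_id product_measure1E// lte_mul_pinfty// ge0_fin_numE.
Qed.

HB.instance Definition _ := Measure_isSigmaFinite.Build _ _ _ lebesgue_cons
  lebesgue_cons_sigma_finite.

End lebesgue_rV_step.

(* Lebesgue measure on R^n as an iterated product; see lebesgue_rV_box. *)
Fixpoint lebesgue_rV (R : realType) (n : nat) :
    {sigma_finite_measure set 'rV[R]_n -> \bar R} :=
  if n is m.+1 then lebesgue_cons (lebesgue_rV R m) else \d_(0 : 'rV[R]_0).

Lemma lebesgue_rV_box (R : realType) (n : nat)
    (A : 'I_n -> set (measurableTypeR R)) :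
  (forall i, measurable (A i)) ->
  (lebesgue_rV R n [set x | forall i, A i (x ord0 i)] =
   \prod_(i < n) lebesgue_measure (A i))%E.
Proof.
elim: n => [|n IH] in A * => mA.
  by rewrite big_ord0 /= diracE mem_set// => -[].
rewrite big_ord_recl -(IH (fun i => A (lift ord0 i)))//.
have mB : measurable [set x : 'rV[R]_n | forall i, A (lift ord0 i) (x ord0 i)].
  rewrite [X in measurable X](_ : _ = \bigcap_(i in [set: 'I_n])
      ((fun x : 'rV[R]_n => x ord0 i) @^-1` A (lift ord0 i))).
    apply: fin_bigcap_measurable => [|i _]; first exact: finite_finset.
    rewrite -[X in measurable X]setTI.
    exact: (measurable_coord (T := R) i measurableT (mA (lift ord0 i))).
  by apply/seteqP; split=> [x xA i _|x xA i]; [exact: xA|exact: (xA i)].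
rewrite -product_measure1E//.
rewrite /= /lebesgue_cons /pushforward; congr (_ _); apply/seteqP.
split=> [p pA|p [p0 pS] i] /=.
  split=> [|i /=]; first by have := pA ord0; rewrite cons_rV0.
  by have := pA (lift ord0 i); rewrite cons_rVS.
by case: (unliftP ord0 i) => [j|] ->; rewrite ?cons_rVS ?cons_rV0.
Qed.

Section complex_valued_integration.
Context d (T : measurableType d) (R : realType).
Variable mu : {measure set T -> \bar R}.
Implicit Types (f : T -> R[i]) (p : \bar R).

Definition Cintegral f : R[i] :=
  (\int[mu]_x complex.Re (f x)) +i* (\int[mu]_x complex.Im (f x)).

Definition CLnorm p f : \bar R := Lnorm mu p (fun x => (ComplexField.Normc.normc (f x))%:E).

Definition CLfun p f : Prop :=
  [/\ measurable_fun setT (fun x => complex.Re (f x)),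
      measurable_fun setT (fun x => complex.Im (f x)) & (CLnorm p f < +oo)%E].

End complex_valued_integration.

Section smooth_functions.
Context (R : realType) (V : normedModType R).
Implicit Types (f : V -> R[i]) (u : V -> R) (vs : seq V).

Fixpoint iter_derive vs u : V -> R :=
  if vs is v :: vs' then fun x => 'D_v (iter_derive vs' u) x else u.

(* For V = R^n, taking the directions vs among all vectors rather than in the
   canonical basis only adds linear combinations of partial derivatives. *)
Definition smooth u : Prop := forall vs,
  continuous (iter_derive vs u) /\
  forall x v, derivable (iter_derive vs u) x v.

Definition Csmooth f : Prop :=
  smooth (fun x => complex.Re (f x)) /\ smooth (fun x => complex.Im (f x)).

Definition Cc_infty f : Prop :=
  Csmooth f /\ compact (closure [set x | f x != 0]).

Definition rapidly_decreasing u : Prop := forall (k : nat) vs,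
  exists M : R, forall x, `|x| ^+ k * `|iter_derive vs u x| <= M.

Definition schwartz f : Prop :=
  [/\ Csmooth f, rapidly_decreasing (fun x => complex.Re (f x)) &
      rapidly_decreasing (fun x => complex.Im (f x))].

End smooth_functions.

Section localization_operators.
Context (R : realType) (d : nat).
Local Notation leb := (lebesgue_rV R d).
Implicit Types (phi f g h : 'rV[R]_d -> R[i]).
Implicit Types (a : 'rV[R]_d * 'rV[R]_d -> R[i]) (r : \bar R).

Definition dotV (x y : 'rV[R]_d) : R := \sum_(i < d) x ord0 i * y ord0 i.

Definition expi (theta : R) : R[i] := cos theta +i* sin theta.

Definition stft phi f (x w : 'rV[R]_d) : R[i] :=
  Cintegral leb (fun t =>
    f t * conjc (phi (t - x)) * expi (- (2 * pi * dotV w t))).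

Definition inner f g : R[i] := Cintegral leb (fun t => f t * conjc (g t)).

(* g |-> <A_a^{phi1,phi2} f, g> *)
Definition locop a phi1 phi2 f g : R[i] :=
  Cintegral (leb \x leb)%E (fun z =>
    a z * stft phi1 f z.1 z.2 * conjc (stft phi2 g z.1 z.2)).

(* The functional A_a^{phi1,phi2} f on the Schwartz class is (represented by) a
   function of L^r, of norm at most K. *)
Definition locop_Lnorm_le r a phi1 phi2 f (K : \bar R) : Prop :=
  exists h, [/\ CLfun leb r h,
    forall g, schwartz g -> inner h g = locop a phi1 phi2 f g &
    (CLnorm leb r h <= K)%E].

Definition locop_bounded r a phi1 phi2 : Prop :=
  exists C : R, forall f, CLfun leb r f ->
    locop_Lnorm_le r a phi1 phi2 f (C%:E * CLnorm leb r f)%E.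

End localization_operators.

(* Main.v *)
From HB Require Import structures.
From mathcomp Require Import all_boot all_order all_algebra.
From mathcomp Require Import all_classical all_reals all_analysis.
From mathcomp Require Import measurable_realfun ess_sup_inf complex ring lra.
Require Import Defs.

Set Implicit Arguments.
Unset Strict Implicit.
Unset Printing Implicit Defensive.
Import Order.TTheory GRing.Theory Num.Theory.
Import numFieldNormedType.Exports.

Local Open Scope classical_set_scope.
Local Open Scope ring_scope.
Local Open Scope complex_scope.

(* Let P_n^0, P_n^1 be the Rudin-Shapiro polynomials with N = 2^n unimodular
   coefficients, so that |P_n^0|^2 + |P_n^1|^2 = 2N pointwise. Take a symbol
   a(x, w) = alpha(x) beta(w), where beta is a signed sum of N disjoint translates
   of a bump along the first frequency axis: it is bounded uniformly in N, its
   support has volume of order N, and its inverse Fourier transform is a fixed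
   function times P_n^b. Test the operator between a spike of width 1/N in the
   first coordinate and a function of unit width modulated by P_n^b, of size at
   most sqrt(2N). Summing over b, the identity above bounds the pairing from below
   by a constant. Hence, by boundedness, a constant is at most
   N^(1/q) N^(-1/r) N^(1/2), and exchanging the two test functions turns -1/r into
   1/r - 1; let N go to infinity.

   When only the boundedness of each single operator is known, the symbols for a
   sparse sequence of N are put at disjoint positions in x, with weights
   2^-m N^(-1/q), into one symbol of L^q. *)

(** * Smooth and compactly supported functions *)

(** In the pairing, written as an integral over the positions [s] of the spike and [t] of the flat
    function, the kernel splits into a spatial factor, nonnegative because the windows are, and the
    inverse Fourier transform of beta at [t - s]. Since [s] is within order 1/N of the centre along
    the first axis, the latter is almost a constant times P_n^b at [t] minus the centre, and the
    conjugate modulation of the flat function turns it into |P_n^b|^2. The supports are so small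
    that they lie inside a fraction of one period of P_n^b. There a single P_n^b may be small, and
    orthogonality of the exponentials says nothing; the Rudin-Shapiro identity holds pointwise,
    hence the sum over b. Flatness in sup norm is wanted because the second function is measured in
    an arbitrary dual exponent: on a bounded set the bound sqrt(2N) controls all of these at once.
    When the bound depends on the symbol, the sign b is chosen at each scale from the lower bound
    alone, before the combined symbol is formed. *)

Section smooth_closure.
Context (R : realType) (V : normedModType R).
Implicit Types (u w : V -> R) (v : V) (vs : seq V).

(** Derivatives of members of [P] remain in [P], so the infinitely many conditions in [smooth]
    reduce to one round of regularity. The closure results below then only have to exhibit a class
    stable under derivatives. *)
Lemma smooth_stable (P : (V -> R) -> Prop) :
  (forall u v, P u -> P ('D_v u)) ->
  (forall u, P u -> continuous u /\ forall x v, derivable u x v) ->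
  forall u, P u -> smooth u.
Proof.
move=> PD Pc u Pu vs; suff : P (iter_derive vs u) by move/Pc.
by elim: vs => [//|v vs IH] /=; exact: PD.
Qed.

Lemma smooth_continuous u : smooth u -> continuous u.
Proof. by move=> /(_ [::])[]. Qed.

Lemma smooth_derivable u : smooth u -> forall x v, derivable u x v.
Proof. by move=> /(_ [::])[]. Qed.

Lemma iter_derive_rcons vs v u :
  iter_derive (rcons vs v) u = iter_derive vs ('D_v u).
Proof. by elim: vs => [|w vs IH] //=; rewrite IH. Qed.

Lemma smooth_derive u v : smooth u -> smooth ('D_v u).
Proof. by move=> su vs; rewrite -iter_derive_rcons; exact: su. Qed.

(** Products alone are not stable under derivatives: the Leibniz rule yields sums of products.
    Closing under sums makes [smooth_stable] applicable. *)
Inductive smooth_products : (V -> R) -> Prop :=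
| smooth_products_mul u w : smooth u -> smooth w ->
    smooth_products (fun x => u x * w x)
| smooth_products_add u w : smooth_products u -> smooth_products w ->
    smooth_products (fun x => u x + w x).

Lemma smooth_products_regular u : smooth_products u ->
  continuous u /\ forall x v, derivable u x v.
Proof.
elim=> {}u w.
  move=> su sw; split=> [x|x v].
    by apply: cvgM; apply: smooth_continuous.
  by apply: derivableM; apply: smooth_derivable.
move=> _ [cu du] _ [cw dw]; split=> [x|x v].
  by apply: cvgD; [exact: cu|exact: cw].
exact: derivableD.
Qed.

Lemma smooth_products_derive u v : smooth_products u ->
  smooth_products ('D_v u).
Proof.
elim=> {}u w.
  move=> su sw.
  rewrite (_ : 'D_v _ = fun x => u x * 'D_v w x + w x * 'D_v u x).
    apply: (smooth_products_add (u := fun x => u x * 'D_v w x)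
      (w := fun x => w x * 'D_v u x)).
      exact: (smooth_products_mul su (smooth_derive v sw)).
    exact: (smooth_products_mul sw (smooth_derive v su)).
  by apply/funext => x; rewrite deriveM//; exact: smooth_derivable.
move=> /smooth_products_regular[_ du] Du /smooth_products_regular[_ dw] Dw.
rewrite (_ : 'D_v _ = fun x => 'D_v u x + 'D_v w x).
  exact: smooth_products_add.
by apply/funext => x; rewrite deriveD.
Qed.

Lemma smooth_products_smooth u : smooth_products u -> smooth u.
Proof.
apply: smooth_stable => {}u; first by move=> v; exact: smooth_products_derive.
exact: smooth_products_regular.
Qed.

Lemma smoothM u w : smooth u -> smooth w -> smooth (fun x => u x * w x).
Proof.
by move=> su sw; apply: smooth_products_smooth; exact: smooth_products_mul.
Qed.

Lemma smooth_cst (c : R) : smooth (fun _ : V => c).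
Proof.
apply: (@smooth_stable (fun u => exists c : R, u = fun _ : V => c)); last by exists c.
  by move=> _ v [k ->]; exists 0; apply/funext => x; rewrite derive_cst.
move=> _ [k ->]; split=> [x|x v]; first exact: cvg_cst.
exact: derivable_cst.
Qed.

Lemma smoothD u w : smooth u -> smooth w -> smooth (fun x => u x + w x).
Proof.
move=> su sw; apply: smooth_products_smooth.
rewrite (_ : (fun _ => _) = fun x => u x * 1 + w x * 1).
  exact: (smooth_products_add (smooth_products_mul su (smooth_cst 1))
    (smooth_products_mul sw (smooth_cst 1))).
by apply/funext => x; rewrite !mulr1.
Qed.

Lemma smoothZ (c : R) u : smooth u -> smooth (fun x => c * u x).
Proof. exact: smoothM (smooth_cst c). Qed.

Lemma smoothN u : smooth u -> smooth (fun x => - u x).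
Proof.
move=> /(smoothZ (-1)); rewrite (_ : (fun _ => _) = fun x => - u x)//.
by apply/funext => x; rewrite mulN1r.
Qed.

Lemma smoothB u w : smooth u -> smooth w -> smooth (fun x => u x - w x).
Proof. by move=> su sw; exact: (smoothD su (smoothN sw)). Qed.

Definition csupp u := exists2 K : set V,
  compact K & forall x, ~ K x -> u x = 0.

Lemma derive_off (K : set V) u v : closed K -> (forall x, ~ K x -> u x = 0) ->
  forall x, ~ K x -> 'D_v u x = 0.
Proof.
move=> cK uK x nKx.
rewrite (@near_eq_derive _ _ _ u (fun=> 0)) ?derive_cst//.
have : open_nbhs x (~` K) by split=> //; exact: closed_openC.
by move=> /open_nbhs_nbhs; apply: filterS => z; exact: uK.
Qed.

(** The complement of [K] is open, so every iterated derivative vanishes there too; the weighted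
    derivative is then a continuous function living on a compact set. *)
Lemma csupp_rapid u : smooth u -> csupp u -> rapidly_decreasing u.
Proof.
move=> su [K cK uK] k vs.
have clK : closed K by apply: compact_closed cK; exact: norm_hausdorff.
have off : forall x, ~ K x -> iter_derive vs u x = 0.
  by elim: vs => [//|v vs IH] /=; exact: derive_off.
have cont : continuous (fun x => `|x| ^+ k * `|iter_derive vs u x|).
  move=> x; apply: cvgM; last by apply: cvg_norm; exact: (su vs).1.
  apply: (@continuous_comp _ _ _ (fun x : V => `|x|) (fun t : R => t ^+ k)).
    exact: norm_continuous.
  exact: exprn_continuous.
have [M [_ Mb]] : bounded_set ((fun x => `|x| ^+ k * `|iter_derive vs u x|) @` K).
  by apply: compact_bounded; apply: continuous_compact => //;
    exact: continuous_subspaceT.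
exists (Num.max 0 (M + 1)) => x; have [Kx|nKx] := pselect (K x).
  rewrite le_max; apply/orP; right; apply: le_trans (ler_norm _) _.
  by apply: (Mb (M + 1)); rewrite ?ltrDl//; exists x.
by rewrite off// normr0 mulr0 le_max lexx.
Qed.

Lemma csuppMl u w : csupp u -> csupp (fun x => u x * w x).
Proof. by move=> [K cK uK]; exists K => // x /uK ->; rewrite mul0r. Qed.

Lemma csuppMr u w : csupp w -> csupp (fun x => u x * w x).
Proof. by move=> [K cK uK]; exists K => // x /uK ->; rewrite mulr0. Qed.

Lemma csuppD u w : csupp u -> csupp w -> csupp (fun x => u x + w x).
Proof.
move=> [K cK uK] [L cL wL]; exists (K `|` L); first exact: compactU.
by move=> x /not_orP[/uK -> /wL ->]; rewrite addr0.
Qed.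

Lemma csupp_bounded u : continuous u -> csupp u ->
  exists M, forall x, `|u x| <= M.
Proof.
move=> cu [K cK uK].
have [M [_ Mb]] : bounded_set (u @` K).
  by apply: compact_bounded; apply: continuous_compact => //;
    exact: continuous_subspaceT.
exists (Num.max 0 (M + 1)) => x; have [Kx|nKx] := pselect (K x).
  rewrite le_max; apply/orP; right.
  by apply: (Mb (M + 1)); rewrite ?ltrDl//; exists x.
by rewrite uK// normr0 le_max lexx.
Qed.

End smooth_closure.

Section smooth_composition.
Context (R : realType) (V W : normedModType R).

(** [L] is the linear part of [A]. Difference quotients of [u \o A] along [v] are literally those of
    [u] along [L v], so a derivative is again a smooth function composed with [A]. *)
Lemma smooth_comp_affine (A L : V -> W) (u : W -> R) :
  continuous A -> (forall (h : R) v x, A (h *: v + x) = h *: L v + A x) ->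
  smooth u -> smooth (u \o A).
Proof.
move=> cA AL su.
apply: (@smooth_stable _ _ (fun w => exists2 u, smooth u & w = u \o A));
  last by exists u.
  move=> _ v [{su}u su ->]; exists ('D_(L v) u); first exact: smooth_derive.
  apply/funext => x; rewrite /derive /=.
  by under eq_fun do rewrite /= AL.
move=> _ [{su}u su ->]; split=> [x|x v].
  by apply: continuous_comp; [exact: cA|exact: smooth_continuous].
have : derivable u (A x) (L v) by exact: smooth_derivable.
rewrite /derivable /=.
by under [in X in _ -> X]eq_fun do rewrite /= AL.
Qed.

Lemma csupp_comp (A : V -> W) (B : W -> V) (u : W -> R) :
  continuous B -> cancel A B -> csupp u -> csupp (u \o A).
Proof.
move=> cB AB [K cK uK]; exists (B @` K).
  by apply: continuous_compact => //; exact: continuous_subspaceT.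
by move=> x nKx /=; apply: uK => KAx; apply: nKx; exists (A x).
Qed.

End smooth_composition.

Section smooth_trigo.
Context (R : realType).

Lemma derive_scaler (f : R -> R) (x v : R) : derivable f x 1 ->
  derivable f x v /\ 'D_v f x = v * 'D_1 f x.
Proof.
move=> /derivable1_diffP df; split; first exact: diff_derivable.
by rewrite !deriveE// -[v in LHS]mulr1 -[v * 1]/(v *: 1) linearZ.
Qed.

(** Neither function is stable under differentiation on its own, but the span of the two is. *)
Lemma smooth_cos_sin (c : R) :
  smooth (fun x : R => cos (c * x)) /\ smooth (fun x : R => sin (c * x)).
Proof.
pose P (w : R -> R) := exists a b : R,
  w = fun x => a * cos (c * x) + b * sin (c * x).
have dP a b (x : R) : is_derive x 1
    (fun x : R => a * cos (c * x) + b * sin (c * x))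
    (b * c * cos (c * x) + (- (a * c)) * sin (c * x)).
  apply: is_derive_eq; rewrite /GRing.scale /=; ring.
have Psmooth : forall w, P w -> smooth w.
  apply: smooth_stable => [_ v [a [b ->]]|_ [a [b ->]]].
    exists (v * (b * c)), (v * - (a * c)); apply/funext => x.
    have [d Dd] := dP a b x.
    have [_ ->] := derive_scaler v d.
    by rewrite Dd; ring.
  split=> [x|x v].
    apply: differentiable_continuous; apply/derivable1_diffP.
    by have [] := dP a b x.
  by have [d _] := dP a b x; have [] := derive_scaler v d.
split; apply: Psmooth.
  by exists 1, 0; apply/funext => x; rewrite mul1r mul0r addr0.
by exists 0, 1; apply/funext => x; rewrite mul1r mul0r add0r.
Qed.

End smooth_trigo.
(** * Integration of complex-valued functions *)

Section borel_rV.
Context (R : realType) (n : nat).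

(** Second countability: [U] is the union of the cubes it contains with rational centre and radius
    1/(m+1), and each cube is a finite intersection of preimages under coordinates. *)
Lemma open_measurable_rV (U : set 'rV[R]_n) : open U -> measurable U.
Proof.
move=> oU.
pose box (p : 'rV[rat]_n * nat) : set 'rV[R]_n :=
  [set x | forall i, `|x ord0 i - ratr (p.1 ord0 i)| < p.2.+1%:R^-1].
have mbox p : measurable (box p).
  rewrite [X in measurable X](_ : _ = \bigcap_(i in [set: 'I_n])
      ((fun x : 'rV[R]_n => x ord0 i) @^-1`
        (ball (ratr (p.1 ord0 i) : R) p.2.+1%:R^-1))).
    apply: fin_bigcap_measurable => [|i _]; first exact: finite_finset.
    rewrite -[X in measurable X]setTI.
    by apply: (measurable_coord (T := R)) => //; exact: open_measurable (ball_open _ _).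
  apply/seteqP; split=> [x xA i _|x xA i] /=.
    by have := xA i; rewrite /ball /= distrC.
  by have := xA i I; rewrite /ball /= distrC.
rewrite (_ : U = \bigcup_(p in [set: 'rV[rat]_n * nat])
    (if `[< box p `<=` U >] then box p else set0)).
  apply: countable_bigcupT_measurable; first exact: countableP.
  by move=> p; case: ifP.
apply/seteqP; split=> [x Ux|x [p _]]; last first.
  by case: ifP => // /asboolP; exact.
have /nbhs_ballP[e /= e0 eU] : nbhs x U by apply: open_nbhs_nbhs; split.
have [k ke] : exists k : nat, k.+1%:R^-1 < e / 2.
  exists (Num.truncn (e / 2)^-1); rewrite invf_plt ?posrE//; last by rewrite divr_gt0.
  by rewrite truncnS_gt.
have k0 : 0 < (k.+1%:R^-1 : R) by rewrite invr_gt0.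
have qx i : exists q : rat, `|x ord0 i - ratr q| < k.+1%:R^-1.
  have [|q] := @rat_in_itvoo R (x ord0 i - k.+1%:R^-1) (x ord0 i + k.+1%:R^-1).
    by rewrite ltrBlDr -addrA ltrDl addr_gt0.
  rewrite in_itv/= => /andP[xq qx]; exists q.
  by rewrite ltr_distlC xq qx.
have [q qP] := choice qx.
exists (\row_i q i, k) => //; rewrite asboolT => /= [i|z zb]; first by rewrite mxE.
apply: eU => /=; split=> // i j; rewrite !ord1 /ball /=.
have := zb j; have := qP j; rewrite !mxE/= => xq zq.
rewrite -(subrK (ratr (q j)) (x ord0 j)) -addrA.
apply: le_lt_trans (ler_normD _ _) _.
have qz : `|ratr (q j) - z ord0 j| < k.+1%:R^-1 by rewrite distrC.
move: xq qz ke; move: (k.+1%:R^-1) => t *; lra.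
Qed.

Lemma continuous_measurable_rV (f : 'rV[R]_n -> R) :
  continuous f -> measurable_fun setT f.
Proof.
move=> cf; apply: (measurability _ (RGenOpens.measurableE R)) => _ [_ [a [b ->] <-]].
rewrite setTI; apply: open_measurable_rV.
by apply: open_comp => // x _; exact: cf.
Qed.

End borel_rV.

Section complex_integral.
Context d (T : measurableType d) (R : realType).
Variable mu : {measure set T -> \bar R}.
Implicit Types (f g : T -> R) (F G : T -> R[i]).

Definition bmeas f := measurable_fun setT f /\ exists M, forall x, `|f x| <= M.

(** Most integrands below are of this kind. The class is stable under multiplication by bounded
    measurable functions, tensor products and translations, and its members are integrable, so
    integrability follows from the shape of the integrand. *)
Definition bsupp f := bmeas f /\ exists E,
  [/\ measurable E, (mu E < +oo)%E & forall x, ~ E x -> f x = 0].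

Lemma bmeasD f g : bmeas f -> bmeas g -> bmeas (fun x => f x + g x).
Proof.
move=> [mf [M fM]] [mg [N gN]]; split; first exact: measurable_funD.
by exists (M + N) => x; apply: le_trans (ler_normD _ _) _; exact: lerD.
Qed.

Lemma bmeasM f g : bmeas f -> bmeas g -> bmeas (fun x => f x * g x).
Proof.
move=> [mf [M fM]] [mg [N gN]]; split; first exact: measurable_funM.
by exists (M * N) => x; rewrite normrM ler_pM.
Qed.

Lemma bmeasN f : bmeas f -> bmeas (fun x => - f x).
Proof.
move=> [mf [M fM]]; split; first exact: measurableT_comp.
by exists M => x; rewrite normrN.
Qed.

Lemma bmeas_cst (c : R) : bmeas (fun=> c).
Proof. by split; [exact: measurable_cst|exists `|c|]. Qed.

Lemma bsuppD f g : bsupp f -> bsupp g -> bsupp (fun x => f x + g x).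
Proof.
move=> [bf [E [mE Eoo fE]]] [bg [F [mF Foo gF]]]; split; first exact: bmeasD.
exists (E `|` F); split; first exact: measurableU.
  apply: le_lt_trans (measureU2 _ _ _) _ => //.
  by rewrite lte_add_pinfty.
by move=> x /not_orP[/fE -> /gF ->]; rewrite addr0.
Qed.

Lemma bsuppMl f g : bsupp f -> bmeas g -> bsupp (fun x => f x * g x).
Proof.
move=> [bf [E [mE Eoo fE]]] bg; split; first exact: bmeasM.
by exists E; split=> // x /fE ->; rewrite mul0r.
Qed.

Lemma bsuppMr f g : bmeas f -> bsupp g -> bsupp (fun x => f x * g x).
Proof.
move=> bf [bg [E [mE Eoo gE]]]; split; first exact: bmeasM.
by exists E; split=> // x /gE ->; rewrite mulr0.
Qed.

Lemma bsuppN f : bsupp f -> bsupp (fun x => - f x).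
Proof.
move=> [bf [E [mE Eoo fE]]]; split; first exact: bmeasN.
by exists E; split=> // x /fE ->; rewrite oppr0.
Qed.

Lemma bsupp_integrable f : bsupp f -> mu.-integrable setT (EFin \o f).
Proof.
move=> [[mf [M fM]] [E [mE Eoo fE]]].
have : mu.-integrable E (EFin \o f).
  apply: measurable_bounded_integrable => //; first exact: measurable_funTS.
  exists M; split; first exact: num_real.
  by move=> N MN x _; exact: le_trans (fM x) (ltW MN).
rewrite (integrable_mkcond _ mE); apply: eq_integrable => // x _.
rewrite patchE; case: ifPn => // /negP; rewrite inE => nEx.
by rewrite /= fE.
Qed.

Definition Cbmeas F := bmeas (fun x => complex.Re (F x)) /\
                       bmeas (fun x => complex.Im (F x)).
Definition Cbsupp F := bsupp (fun x => complex.Re (F x)) /\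
                       bsupp (fun x => complex.Im (F x)).

Lemma ReM (z w : R[i]) : complex.Re (z * w) =
  complex.Re z * complex.Re w - complex.Im z * complex.Im w.
Proof. by case: z => a b; case: w. Qed.

Lemma ImM (z w : R[i]) : complex.Im (z * w) =
  complex.Re z * complex.Im w + complex.Im z * complex.Re w.
Proof. by case: z => a b; case: w. Qed.

Lemma Cbmeas_cst (c : R[i]) : Cbmeas (fun=> c).
Proof. by split; exact: bmeas_cst. Qed.

Lemma CbmeasM F G : Cbmeas F -> Cbmeas G -> Cbmeas (fun x => F x * G x).
Proof.
move=> [F1 F2] [G1 G2]; split.
  under eq_fun do rewrite ReM.
  exact: bmeasD (bmeasM F1 G1) (bmeasN (bmeasM F2 G2)).
under eq_fun do rewrite ImM.
exact: bmeasD (bmeasM F1 G2) (bmeasM F2 G1).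
Qed.

Lemma CbsuppMl F G : Cbsupp F -> Cbmeas G -> Cbsupp (fun x => F x * G x).
Proof.
move=> [F1 F2] [G1 G2]; split.
  under eq_fun do rewrite ReM.
  exact: bsuppD (bsuppMl F1 G1) (bsuppN (bsuppMl F2 G2)).
under eq_fun do rewrite ImM.
exact: bsuppD (bsuppMl F1 G2) (bsuppMl F2 G1).
Qed.

Lemma CbsuppMr F G : Cbmeas F -> Cbsupp G -> Cbsupp (fun x => F x * G x).
Proof.
move=> bF bG; under eq_fun do rewrite mulrC.
exact: CbsuppMl.
Qed.

Lemma Cbmeas_conj F : Cbmeas F -> Cbmeas (fun x => conjc (F x)).
Proof.
move=> [F1 F2]; split.
  by rewrite (_ : (fun _ => _) = fun x => complex.Re (F x))//; apply/funext => x; case: (F x).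
rewrite (_ : (fun _ => _) = fun x => - complex.Im (F x)); first exact: bmeasN.
by apply/funext => x; case: (F x).
Qed.

Lemma Cbsupp_conj F : Cbsupp F -> Cbsupp (fun x => conjc (F x)).
Proof.
move=> [F1 F2]; split.
  by rewrite (_ : (fun _ => _) = fun x => complex.Re (F x))//; apply/funext => x; case: (F x).
rewrite (_ : (fun _ => _) = fun x => - complex.Im (F x)); first exact: bsuppN.
by apply/funext => x; case: (F x).
Qed.

Lemma eq_Cintegral F G : F =1 G -> Cintegral mu F = Cintegral mu G.
Proof. by move=> /funext ->. Qed.

Lemma CintegralZ (c : R[i]) F : Cbsupp F ->
  Cintegral mu (fun x => c * F x) = c * Cintegral mu F.
Proof.
move=> [/bsupp_integrable F1 /bsupp_integrable F2].
case: c => a b; rewrite /Cintegral.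
under [in X in X +i* _]eq_Rintegral do rewrite ReM/=.
under [in X in _ +i* X]eq_Rintegral do rewrite ImM/=.
have iZ (k : R) f : mu.-integrable setT (EFin \o f) ->
    mu.-integrable setT (EFin \o (fun x => k * f x)).
  by move=> fi; exact: (integrableZl measurableT k fi).
rewrite RintegralB//; try exact: iZ.
rewrite RintegralD//; try exact: iZ.
by rewrite !RintegralZl.
Qed.

Lemma CintegralD F G : Cbsupp F -> Cbsupp G ->
  Cintegral mu (fun x => F x + G x) = Cintegral mu F + Cintegral mu G.
Proof.
move=> [/bsupp_integrable F1 /bsupp_integrable F2].
move=> [/bsupp_integrable G1 /bsupp_integrable G2].
rewrite /Cintegral.
under [in X in X +i* _]eq_Rintegral do rewrite raddfD/=.
under [in X in _ +i* X]eq_Rintegral do rewrite raddfD/=.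
by rewrite !RintegralD.
Qed.

Lemma Cintegral_conj F : Cbsupp F ->
  Cintegral mu (fun x => conjc (F x)) = conjc (Cintegral mu F).
Proof.
move=> [/bsupp_integrable F1 /bsupp_integrable F2].
rewrite /Cintegral /=; congr (_ +i* _).
  by apply: eq_Rintegral => x _; case: (F x).
rewrite -mulN1r -RintegralZl//; apply: eq_Rintegral => x _.
by case: (F x) => a b /=; rewrite mulN1r.
Qed.

End complex_integral.

(** * Fubini's theorem for complex-valued functions *)

Section sigma_finite_product.
Context d1 d2 (T1 : measurableType d1) (T2 : measurableType d2) (R : realType).
Variable m1 : {sigma_finite_measure set T1 -> \bar R}.
Variable m2 : {sigma_finite_measure set T2 -> \bar R}.

(* The canonical sigma-finite structure of [m1 \x m2] in the library is the one
   of products of subprobabilities, hence this alias. *)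
Definition sfprod : set (T1 * T2) -> \bar R := (m1 \x m2)%E.

HB.instance Definition _ := Measure.on sfprod.

Lemma sigma_finite_sfprod : sigma_finite setT sfprod.
Proof.
have /sigma_finiteP[F [TF ndF Foo]] := sigma_finiteT m1.
have /sigma_finiteP[G [TG ndG Goo]] := sigma_finiteT m2.
exists (fun k => F k `*` G k).
  apply/esym; rewrite -subTset => -[x y] _.
  have [i _ Fi] : (\bigcup_i F i) x by rewrite -TF.
  have [j _ Gj] : (\bigcup_j G j) y by rewrite -TG.
  exists (maxn i j) => //; split.
    by move: Fi; exact/subsetPset/ndF/leq_maxl.
  by move: Gj; exact/subsetPset/ndG/leq_maxr.
move=> k; have [mF Fk] := Foo k; have [mG Gk] := Goo k.
split; first exact: measurableX.
by rewrite /sfprod product_measure1E// lte_mul_pinfty// ge0_fin_numE.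
Qed.

HB.instance Definition _ := Measure_isSigmaFinite.Build _ _ _ sfprod
  sigma_finite_sfprod.

End sigma_finite_product.

Section fubini_complex.
Context d1 d2 (T1 : measurableType d1) (T2 : measurableType d2) (R : realType).
Variable m1 : {sigma_finite_measure set T1 -> \bar R}.
Variable m2 : {sigma_finite_measure set T2 -> \bar R}.

Lemma bmeas_fst (f : T1 -> R) : bmeas f -> bmeas (fun z : T1 * T2 => f z.1).
Proof.
move=> [mf [M fM]]; split; last by exists M.
exact: (measurableT_comp mf measurable_fst).
Qed.

Lemma bmeas_snd (f : T2 -> R) : bmeas f -> bmeas (fun z : T1 * T2 => f z.2).
Proof.
move=> [mf [M fM]]; split; last by exists M.
exact: (measurableT_comp mf measurable_snd).
Qed.

Lemma bsuppX (f : T1 -> R) (g : T2 -> R) : bsupp m1 f -> bsupp m2 g ->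
  bsupp (m1 \x m2)%E (fun z => f z.1 * g z.2).
Proof.
move=> [bf [E [mE Eoo fE]]] [bg [F [mF Foo gF]]].
split; first exact: bmeasM (bmeas_fst bf) (bmeas_snd bg).
exists (E `*` F); split; first exact: measurableX.
  apply: (@le_lt_trans _ _ (m1 E * m2 F)%E).
    by rewrite le_eqVlt; apply/orP; left; apply/eqP; exact: product_measure1E.
  by rewrite lte_mul_pinfty// ge0_fin_numE.
by move=> z /not_andP[/fE -> |/gF ->]; rewrite (mul0r, mulr0).
Qed.

Lemma CbsuppX (F : T1 -> R[i]) (G : T2 -> R[i]) : Cbsupp m1 F -> Cbsupp m2 G ->
  Cbsupp (m1 \x m2)%E (fun z => F z.1 * G z.2).
Proof.
move=> [F1 F2] [G1 G2]; split.
  under eq_fun do rewrite ReM.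
  exact: bsuppD (bsuppX F1 G1) (bsuppN (bsuppX F2 G2)).
under eq_fun do rewrite ImM.
exact: bsuppD (bsuppX F1 G2) (bsuppX F2 G1).
Qed.

(** The inner integral may be infinite for a null set of [x], where [fine] turns it into 0; the
    integrands with and without [fine] thus agree only almost everywhere. *)
Lemma Rintegral_prod1 (f : T1 * T2 -> R) :
  (m1 \x m2)%E.-integrable setT (EFin \o f) ->
  \int[m1]_x (\int[m2]_y f (x, y)) = \int[(m1 \x m2)%E]_z f z.
Proof.
move=> fi; rewrite [RHS]/Rintegral -integral12_prod_meas1//.
rewrite [LHS]/Rintegral; congr fine; apply: ae_eq_integral => //.
- apply/measurable_EFinP.
  exact: (measurableT_comp (fine_measurable (R := R) measurableT) (measurable_fubini_F fi)).
- exact: (measurable_fubini_F fi).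
- apply: filterS (ae_integrable1 fi) => x fx _.
  by rewrite fineK//; exact: integrable_fin_num.
Qed.

Lemma Rintegral_prod2 (f : T1 * T2 -> R) :
  (m1 \x m2)%E.-integrable setT (EFin \o f) ->
  \int[m2]_y (\int[m1]_x f (x, y)) = \int[(m1 \x m2)%E]_z f z.
Proof.
move=> fi; rewrite [RHS]/Rintegral -integral21_prod_meas1//.
rewrite [LHS]/Rintegral; congr fine; apply: ae_eq_integral => //.
- apply/measurable_EFinP.
  exact: (measurableT_comp (fine_measurable (R := R) measurableT) (measurable_fubini_G fi)).
- exact: (measurable_fubini_G fi).
- apply: filterS (ae_integrable2 fi) => x fx _.
  by rewrite fineK//; exact: integrable_fin_num.
Qed.

Lemma Cintegral_swap (F : T1 * T2 -> R[i]) : Cbsupp (m1 \x m2)%E F ->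
  Cintegral m1 (fun x => Cintegral m2 (fun y => F (x, y))) =
  Cintegral m2 (fun y => Cintegral m1 (fun x => F (x, y))).
Proof.
move=> [/bsupp_integrable F1 /bsupp_integrable F2]; congr (_ +i* _) => /=.
  by rewrite (Rintegral_prod1 F1) (Rintegral_prod2 F1).
by rewrite (Rintegral_prod1 F2) (Rintegral_prod2 F2).
Qed.

Lemma Rintegral_prodM (f : T1 -> R) (g : T2 -> R) : bsupp m1 f -> bsupp m2 g ->
  \int[(m1 \x m2)%E]_z (f z.1 * g z.2) = \int[m1]_x f x * \int[m2]_y g y.
Proof.
move=> bf bg; rewrite -(Rintegral_prod1 (bsupp_integrable (bsuppX bf bg)))/=.
rewrite -RintegralZr//; last exact: bsupp_integrable.
by apply: eq_Rintegral => x _; rewrite RintegralZl//; exact: bsupp_integrable.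
Qed.

Lemma Cintegral_prodM (F : T1 -> R[i]) (G : T2 -> R[i]) :
  Cbsupp m1 F -> Cbsupp m2 G ->
  Cintegral (m1 \x m2)%E (fun z => F z.1 * G z.2) =
  Cintegral m1 F * Cintegral m2 G.
Proof.
move=> [F1 F2] [G1 G2].
have iX f g : bsupp m1 f -> bsupp m2 g ->
    (m1 \x m2)%E.-integrable setT (EFin \o (fun z => f z.1 * g z.2)).
  by move=> bf bg; exact/bsupp_integrable/bsuppX.
rewrite /Cintegral.
under [in X in X +i* _ = _]eq_Rintegral do rewrite ReM/=.
under [in X in _ +i* X = _]eq_Rintegral do rewrite ImM/=.
rewrite (RintegralB measurableT (iX _ _ F1 G1) (iX _ _ F2 G2)).
rewrite (RintegralD measurableT (iX _ _ F1 G2) (iX _ _ F2 G1)).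
by rewrite (Rintegral_prodM F1 G1) (Rintegral_prodM F1 G2)
  (Rintegral_prodM F2 G1) (Rintegral_prodM F2 G2).
Qed.

(** Partial integrals inherit measurability and integrability from Fubini and Tonelli. The kernel
    form of the pairing is such a partial integral, and so becomes integrable without any estimate
    on the kernel. *)
Lemma integrable_Re_Cintegral (F : T1 * T2 -> R[i]) : Cbsupp (m1 \x m2)%E F ->
  m2.-integrable setT (EFin \o
    (fun y => complex.Re (Cintegral m1 (fun x => F (x, y))))).
Proof.
move=> [/bsupp_integrable F1 _]; have mF := measurable_int _ F1.
have mG := measurable_fubini_G F1.
have mR : measurable_fun setT
    (fun y => (complex.Re (Cintegral m1 (fun x => F (x, y))))%:E).
  apply/measurable_EFinP.
  exact: (measurableT_comp (fine_measurable (R := R) measurableT) mG).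
apply/integrableP; split=> //.
apply: le_lt_trans ((integrable21ltyP m1 m2 mF).1 F1).
apply: ge0_le_integral => //.
- exact: measurableT_comp.
- apply: (@measurable_fun_fubini_tonelli_G _ _ _ _ R m1
    (abse \o (EFin \o (fun z => complex.Re (F z))))) => //.
    exact: measurableT_comp.
  by move=> z; exact: abse_ge0.
move=> y _; have mFy := measurable_fun_pair1 y mF.
(* [fine] sends infinite values to 0, so it never increases the absolute value. *)
apply: (@le_trans _ _ `|\int[m1]_x (complex.Re (F (x, y)))%:E|%E).
  rewrite /= /Rintegral.
  by move: (\int[m1]_x _)%E => [x| |] //=; rewrite normr0 leey.
exact: le_abse_integral.
Qed.

End fubini_complex.

(** * Translation invariance of Lebesgue measure *)

Section translation.
Context (R : realType).

Definition shiftR (c : R) (x : measurableTypeR R) : measurableTypeR R := x - c.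

Lemma measurable_shiftR c : measurable_fun setT (shiftR c).
Proof.
by apply: measurable_funB; [exact: measurable_id|exact: measurable_cst].
Qed.

HB.instance Definition _ (c : R) := isMeasurableFun.Build _ _ _ _ (shiftR c)
  (measurable_shiftR c).

Lemma lebesgue_measure_shift (c : R) (A : set (measurableTypeR R)) :
  measurable A -> lebesgue_measure (shiftR c @^-1` A) = lebesgue_measure A.
Proof.
move=> mA; apply/esym.
rewrite -[RHS]/(pushforward lebesgue_measure (shiftR c) A).
apply: lebesgue_measure_unique => // _ [[a b]] _ <-.
change (lebesgue_measure `]a, b]%classic =
  lebesgue_measure (shiftR c @^-1` `]a, b]%classic)).
rewrite (_ : _ @^-1` _ = `]a + c, b + c]%classic); last first.
  by apply/seteqP; split=> x /=; rewrite !in_itv /= ltrBrDr lerBlDr.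
rewrite !lebesgue_measure_itv/= !lte_fin ltrD2r.
by case: ifP => // _; rewrite -!EFinD; congr EFin; ring.
Qed.

Definition shift_rV n (c x : 'rV[R]_n) : 'rV[R]_n := x - c.

Lemma measurable_shift_rV n (c : 'rV[R]_n) : measurable_fun setT (shift_rV c).
Proof.
apply: measurable_fun_rVP => i.
under eq_fun do rewrite !mxE.
by apply: measurable_funB => //; exact: (measurable_coord (T := R)).
Qed.

HB.instance Definition _ n (c : 'rV[R]_n) :=
  isMeasurableFun.Build _ _ _ _ (shift_rV c) (measurable_shift_rV c).

Definition shift_prod n (c : measurableTypeR R * 'rV[R]_n) (p : measurableTypeR R * 'rV[R]_n) :
  measurableTypeR R * 'rV[R]_n := (shiftR c.1 p.1, shift_rV c.2 p.2).

Lemma measurable_shift_prod n (c : measurableTypeR R * 'rV[R]_n) :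
  measurable_fun setT (shift_prod c).
Proof.
apply/measurable_fun_pairP; split.
  exact: (measurableT_comp (measurable_shiftR c.1) measurable_fst).
exact: (measurableT_comp (measurable_shift_rV c.2) measurable_snd).
Qed.

HB.instance Definition _ n (c : measurableTypeR R * 'rV[R]_n) :=
  isMeasurableFun.Build _ _ _ _ (shift_prod c) (measurable_shift_prod c).

(** Induction on the dimension: in the coordinates of [cons_rV] a shift is a product of two shifts,
    and a measure that agrees with the product measure on rectangles is equal to it. *)
Lemma lebesgue_rV_shift n (c : 'rV[R]_n) (A : set 'rV[R]_n) : measurable A ->
  lebesgue_rV R n (shift_rV c @^-1` A) = lebesgue_rV R n A.
Proof.
elim: n => [|n IH] in c A *.
  by move=> _; rewrite (_ : _ @^-1` A = A)//; apply/funext => x /=; congr A;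
    apply/rowP => -[].
move=> mA; rewrite /= /lebesgue_cons /pushforward.
rewrite (_ : _ @^-1` (_ @^-1` A) =
    shift_prod (uncons_rV c) @^-1` ((@cons_rV R n) @^-1` A)); last first.
  apply/funext => p /=; congr A; apply/rowP => i; rewrite !mxE.
  by case: (unliftP ord0 i) => [j|] ->; rewrite ?mxE.
apply/esym.
rewrite -[RHS]/(pushforward (lebesgue_measure \x lebesgue_rV R n)%E
  (shift_prod (uncons_rV c)) _).
apply: product_measure_unique.
  move=> B C mB mC.
  change ((lebesgue_measure \x lebesgue_rV R n)%E
    ((shiftR (uncons_rV c).1 @^-1` B) `*` (shift_rV (uncons_rV c).2 @^-1` C)) =
    (lebesgue_measure B * lebesgue_rV R n C)%E).
  apply: etrans (product_measure1E _ _ _ _) _.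
  - by rewrite -[X in measurable X]setTI; exact: measurable_shiftR.
  - by rewrite -[X in measurable X]setTI; exact: measurable_shift_rV.
  - by congr (_ * _)%E; [exact: lebesgue_measure_shift|exact: IH].
by rewrite -[X in measurable X]setTI; exact: measurable_cons_rV.
Qed.

Lemma bsupp_shift n (c : 'rV[R]_n) (f : 'rV[R]_n -> R) :
  bsupp (lebesgue_rV R n) f -> bsupp (lebesgue_rV R n) (fun x => f (x - c)).
Proof.
move=> [[mf [M fM]] [E [mE Eoo fE]]]; split.
  by split; [exact: (measurableT_comp mf (measurable_shift_rV c))|exists M].
exists (shift_rV c @^-1` E); split; last by move=> x; exact: fE.
  by rewrite -[X in measurable X]setTI; exact: measurable_shift_rV.
apply: le_lt_trans Eoo; rewrite le_eqVlt; apply/orP; left; apply/eqP.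
exact: lebesgue_rV_shift.
Qed.

Lemma Rintegral_shift_rV n (c : 'rV[R]_n) (f : 'rV[R]_n -> R) :
  bsupp (lebesgue_rV R n) f ->
  \int[lebesgue_rV R n]_x f (x - c) = \int[lebesgue_rV R n]_x f x.
Proof.
move=> bf; have /bsupp_integrable fi := bsupp_shift c bf.
rewrite /Rintegral; congr fine.
transitivity (\int[pushforward (lebesgue_rV R n) (shift_rV c)]_x (f x)%:E)%E.
  apply/esym.
  apply: etrans (integral_pushforward (measurable_shift_rV c) _ _ measurableT) _.
  - by apply/measurable_EFinP; case: bf => -[].
  - exact: fi.
  - by [].
by apply: eq_measure_integral => A mA _; exact: lebesgue_rV_shift.
Qed.

Lemma Cintegral_shift_rV n (c : 'rV[R]_n) (F : 'rV[R]_n -> R[i]) :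
  Cbsupp (lebesgue_rV R n) F ->
  Cintegral (lebesgue_rV R n) (fun x => F (x - c)) =
  Cintegral (lebesgue_rV R n) F.
Proof.
by move=> [F1 F2]; congr (_ +i* _);
  [exact: (Rintegral_shift_rV c F1)|exact: (Rintegral_shift_rV c F2)].
Qed.

Lemma Cbsupp_shift n (c : 'rV[R]_n) (F : 'rV[R]_n -> R[i]) :
  Cbsupp (lebesgue_rV R n) F -> Cbsupp (lebesgue_rV R n) (fun x => F (x - c)).
Proof.
by move=> [F1 F2]; split; [exact: (bsupp_shift c F1)|exact: (bsupp_shift c F2)].
Qed.

End translation.
(** * Rudin-Shapiro polynomials and symbols *)

Section rudin_shapiro.
Context (R : realType).
Local Notation normc := ComplexField.Normc.normc.
Implicit Types (lam t s x y : R) (n : nat) (b : bool).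

Lemma sqr_normc_ReIm (z : R[i]) :
  normc z ^+ 2 = complex.Re z ^+ 2 + complex.Im z ^+ 2.
Proof. by case: z => x y; rewrite /normc sqr_sqrtr// addr_ge0// sqr_ge0. Qed.

Lemma normc_ge0 (z : R[i]) : 0 <= normc z.
Proof. by case: z => x y; exact: sqrtr_ge0. Qed.

Lemma normr_Re (z : R[i]) : `|complex.Re z| <= normc z.
Proof.
rewrite -(ler_pXn2r (n := 2)) ?nnegrE ?normc_ge0// sqr_normc_ReIm.
by rewrite real_normK ?num_real// lerDl sqr_ge0.
Qed.

Lemma normr_Im (z : R[i]) : `|complex.Im z| <= normc z.
Proof.
rewrite -(ler_pXn2r (n := 2)) ?nnegrE ?normc_ge0// sqr_normc_ReIm.
by rewrite real_normK ?num_real// lerDr sqr_ge0.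
Qed.

Lemma normc_one : normc (1 : R[i]) = 1.
Proof. exact: ComplexField.Normc.normc1. Qed.

Lemma normc_zero : normc (0 : R[i]) = 0.
Proof. exact: ComplexField.Normc.normc0. Qed.

Lemma normc_real x : normc x%:C = `|x|.
Proof. by rewrite /normc /= expr0n /= addr0 sqrtr_sqr. Qed.

Lemma normc_le1norm (z : R[i]) :
  normc z <= `|complex.Re z| + `|complex.Im z|.
Proof.
rewrite -(ler_pXn2r (n := 2)) ?nnegrE ?normc_ge0 ?addr_ge0// sqr_normc_ReIm.
rewrite sqrrD !real_normK ?num_real// lerD2r lerDl.
by rewrite mulrn_wge0// mulr_ge0.
Qed.

Lemma normc_parallelogram (z w : R[i]) :
  normc (z + w) ^+ 2 + normc (z - w) ^+ 2 = 2 * (normc z ^+ 2 + normc w ^+ 2).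
Proof.
by case: z => a b; case: w => c d; rewrite !sqr_normc_ReIm /=; ring.
Qed.

Lemma expiD x y : expi (x + y) = expi x * expi y.
Proof. by rewrite /expi cosD sinD; congr (_ +i* _); rewrite addrC. Qed.

Lemma conjc_expi x : conjc (expi x) = expi (- x).
Proof. by rewrite /expi cosN sinN. Qed.

Lemma normc_expi x : normc (expi x) = 1.
Proof. by rewrite /normc /expi cos2Dsin2 sqrtr1. Qed.

Lemma MVT_lipschitz1 (f df : R -> R) : (forall x, is_derive x 1 f (df x)) ->
  (forall x, `|df x| <= 1) -> forall x y, `|f x - f y| <= `|x - y|.
Proof.
move=> fdf df1.
suff H x y : x <= y -> `|f y - f x| <= `|y - x|.
  by move=> x y; case: (leP x y) => [/H|/ltW/H]//; rewrite distrC (distrC x).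
move=> xy; have [|c _ ->] := @MVT_segment R f df x y xy (fun z _ => fdf z).
  apply: derivable_within_continuous => z _.
  by have [] := fdf z.
by rewrite normrM ler_piMl.
Qed.

Lemma cos_lipschitz x y : `|cos x - cos y| <= `|x - y|.
Proof.
apply: (@MVT_lipschitz1 cos (fun x => - sin x)) => z.
by rewrite normrN sin_max.
Qed.

Lemma sin_lipschitz x y : `|sin x - sin y| <= `|x - y|.
Proof. by apply: (@MVT_lipschitz1 sin cos) => z; exact: cos_max. Qed.

Lemma expi_lipschitz x y : normc (expi x - expi y) <= 2 * `|x - y|.
Proof.
apply: le_trans (normc_le1norm _) _; rewrite mulr2n mulrDl mul1r.
by apply: lerD; [exact: cos_lipschitz|exact: sin_lipschitz].
Qed.

(** The trigonometric polynomial with coefficients 1 or -1 and frequencies [lam * j] for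
    [j < 2 ^+ n]. The booleans false and true stand for the members P and Q of the Rudin-Shapiro
    pair, with recursion P' = P + eQ and Q' = P - eQ for a phase e. *)
Fixpoint rs lam n b t : R[i] :=
  if n is m.+1 then
    rs lam m false t + (-1) ^+ b * (expi (2 * pi * (lam * 2 ^+ m * t)) * rs lam m true t)
  else 1.

Lemma rs0 lam b t : rs lam 0 b t = 1.
Proof. by []. Qed.

(** Parallelogram law: the phase is unimodular, so each step doubles the sum of the squares. *)
Lemma normc_rs2 lam n t :
  normc (rs lam n false t) ^+ 2 + normc (rs lam n true t) ^+ 2 = 2 ^+ n.+1.
Proof.
elim: n => [|n IH]; first by rewrite !rs0 normc_one expr1n expr1.
rewrite [2 ^+ n.+2]exprS -IH /= expr0 expr1 mul1r.
rewrite mulN1r normc_parallelogram.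
by rewrite ComplexField.Normc.normcM normc_expi mul1r.
Qed.

Lemma normc_rs_le lam n b t : normc (rs lam n b t) <= Num.sqrt 2 ^+ n.+1.
Proof.
rewrite -(ler_pXn2r (n := 2)) ?nnegrE ?normc_ge0 ?exprn_ge0 ?sqrtr_ge0//.
rewrite -exprM mulnC exprM sqr_sqrtr// -(normc_rs2 lam n t).
by case: b; rewrite ?lerDl ?lerDr sqr_ge0.
Qed.

(** A form of Bernstein's inequality, degree times sup norm, with a rough constant. In the recursion
    the two halves contribute twice the previous bound while the target grows by 2 sqrt 2; the slack
    absorbs the variation of the phase. With [r] the square root of 2, the constant 60 ensures 4 pi
    r <= 120 (r - 1) even for the crude bounds on pi and [r]. *)
Lemma rs_lipschitz lam n b s t : 0 < lam ->
  normc (rs lam n b t - rs lam n b s) <=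
  60 * lam * 2 ^+ n * Num.sqrt 2 ^+ n * `|t - s|.
Proof.
move=> lam0; set r := Num.sqrt 2.
have r0 : 0 <= r by exact: sqrtr_ge0.
have r2 : r ^+ 2 = 2 by rewrite sqr_sqrtr.
have rge : 7 / 5 <= r.
  by rewrite -(ler_pXn2r (n := 2)) ?nnegrE// r2; lra.
have rle : r <= 3 / 2.
  by rewrite -(ler_pXn2r (n := 2)) ?nnegrE// ?r2; lra.
have pi4 : pi <= 4 :> R by have := @pihalf_lt2 R; lra.
elim: n b => [|n IH] b.
  by rewrite !rs0 subrr normc_zero !mulr_ge0// ltW.
set T := `|t - s|; have T0 : 0 <= T by exact: normr_ge0.
set z := fun t => expi (2 * pi * (lam * 2 ^+ n * t)).
have -> : rs lam n.+1 b t - rs lam n.+1 b s =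
  (rs lam n false t - rs lam n false s) +
  (-1) ^+ b * (z t * (rs lam n true t - rs lam n true s) +
  (z t - z s) * rs lam n true s).
  by rewrite /= /z; ring.
apply: le_trans (le_normcD _ _) _.
have ns : normc ((-1) ^+ b : R[i]) = 1.
  by case: b; rewrite ?expr1 ?expr0 ?normcN normc_one.
rewrite ComplexField.Normc.normcM ns mul1r.
apply: le_trans (lerD (IH false) (le_normcD _ _)) _.
rewrite 2!ComplexField.Normc.normcM normc_expi mul1r.
have H1 : normc (z t - z s) <= 2 * (2 * pi * lam * 2 ^+ n * T).
  apply: le_trans (expi_lipschitz _ _) _; rewrite ler_pM2l//.
  rewrite (_ : _ - _ = 2 * pi * lam * 2 ^+ n * (t - s)); last by ring.
  by rewrite normrM ger0_norm// !mulr_ge0// ?exprn_ge0 ?pi_ge0// ltW.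
have H2 := ler_pM (normc_ge0 _) (normc_ge0 _) H1 (normc_rs_le lam n true s).
apply: le_trans (lerD (lexx _) (lerD (IH true) H2)) _.
rewrite -/r -/T !exprS.
set N := 2 ^+ n; set Q := r ^+ n.
have K0 : 0 <= lam * N * Q * T by rewrite !mulr_ge0 ?exprn_ge0// ltW.
rewrite [leLHS](_ : _ = (lam * N * Q * T) * (120 + 4 * pi * r)); last by ring.
rewrite [leRHS](_ : _ = (lam * N * Q * T) * (120 * r)); last by ring.
apply: ler_wpM2l => //.
have : pi * r <= 4 * (3 / 2) by apply: ler_pM => //; exact: pi_ge0.
lra.
Qed.

Lemma smooth_rs lam n b : smooth (fun t => complex.Re (rs lam n b t)) /\
  smooth (fun t => complex.Im (rs lam n b t)).
Proof.
elim: n b => [|n IH] b; first by split; exact: smooth_cst.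
have [c1 s1] := smooth_cos_sin (2 * pi * (lam * 2 ^+ n)).
have [[fr fi] [tr ti]] := (IH false, IH true).
pose sg : R := (-1) ^+ b.
split.
  rewrite (_ : (fun _ => _) = fun t => complex.Re (rs lam n false t) + sg *
    (cos (2 * pi * (lam * 2 ^+ n) * t) * complex.Re (rs lam n true t) -
     sin (2 * pi * (lam * 2 ^+ n) * t) * complex.Im (rs lam n true t))).
    exact: smoothD fr (smoothZ sg (smoothB (smoothM c1 tr) (smoothM s1 ti))).
  apply/funext => t /=; rewrite raddfD /= !mulrA; congr (_ + _).
  rewrite /sg; clear sg; case: b; rewrite ?expr0 ?expr1 ?mul1r ?mulN1r ?raddfN/= ?ReM/=; ring.
rewrite (_ : (fun _ => _) = fun t => complex.Im (rs lam n false t) + sg *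
    (cos (2 * pi * (lam * 2 ^+ n) * t) * complex.Im (rs lam n true t) +
     sin (2 * pi * (lam * 2 ^+ n) * t) * complex.Re (rs lam n true t))).
  exact: smoothD fi (smoothZ sg (smoothD (smoothM c1 ti) (smoothM s1 tr))).
apply/funext => t /=; rewrite raddfD /= !mulrA; congr (_ + _).
rewrite /sg; clear sg; case: b; rewrite ?expr0 ?expr1 ?mul1r ?mulN1r ?raddfN/= ?ImM/=; ring.
Qed.

End rudin_shapiro.

(** * Signed sums of translated bumps *)

Section rudin_shapiro_symbol.
Context (R : realType) (d : nat).
Local Notation V := 'rV[R]_d.+1.
Local Notation leb := (lebesgue_rV R d.+1).
Implicit Types (psi : V -> R) (lam L M : R) (n : nat) (b : bool) (u w : V).

Definition e0 : V := delta_mx ord0 ord0.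

(** The recursion of [rs] with modulations replaced by translations in frequency, so that the two
    correspond under the Fourier transform. *)
Fixpoint rs_symbol psi lam n b w : R :=
  if n is m.+1 then rs_symbol psi lam m false w +
    (-1) ^+ b * rs_symbol psi lam m true (w - (lam * 2 ^+ m) *: e0)
  else psi w.

Lemma smooth_shift (f : V -> R) (c : V) : smooth f -> smooth (fun x => f (x - c)).
Proof.
move=> sf; apply: (@smooth_comp_affine _ _ _ (fun x : V => x - c) id) => //.
  by move=> x; apply: continuousB => //; exact: cst_continuous.
by move=> h v x; rewrite addrA.
Qed.

Lemma csupp_shift (f : V -> R) (c : V) : csupp f -> csupp (fun x => f (x - c)).
Proof.
apply: (@csupp_comp _ _ _ (fun x : V => x - c) (fun x => x + c)).
  by move=> x; apply: continuousD => //; exact: cst_continuous.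
by move=> x; rewrite subrK.
Qed.

Lemma csuppZ (c : R) (f : V -> R) : csupp f -> csupp (fun x => c * f x).
Proof. exact: csuppMr. Qed.

Lemma smooth_rs_symbol psi lam n b : smooth psi -> smooth (rs_symbol psi lam n b).
Proof.
move=> spsi; elim: n b => [//|n IH] b.
exact: smoothD (IH false) (smoothZ ((-1) ^+ b) (smooth_shift _ (IH true))).
Qed.

Lemma csupp_rs_symbol psi lam n b : csupp psi -> csupp (rs_symbol psi lam n b).
Proof.
move=> cpsi; elim: n b => [//|n IH] b.
exact: csuppD (IH false) (csuppZ ((-1) ^+ b) (csupp_shift _ (IH true))).
Qed.

Lemma bsupp_rs_symbol psi lam n b : bsupp leb psi ->
  bsupp leb (rs_symbol psi lam n b).
Proof.
move=> bpsi; elim: n b => [//|n IH] b.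
exact: bsuppD (IH false) (bsuppMr (bmeas_cst _ ((-1) ^+ b)) (bsupp_shift _ (IH true))).
Qed.

Lemma e0E i : e0 ord0 i = (i == ord0)%:R.
Proof. by rewrite mxE eqxx. Qed.

(** The spacing [2 * L] is the width of a box containing the support of [psi], so the translates lie
    side by side along the first axis, in a strip of length [2 * L * 2 ^+ n] that starts at
    [- L]. *)
Lemma rs_symbol_supp psi L n b : 0 < L ->
  (forall w, psi w != 0 -> forall i, `|w ord0 i| < L) ->
  forall w, rs_symbol psi (2 * L) n b w != 0 ->
    - L < w ord0 ord0 < 2 * L * 2 ^+ n - L /\
    forall i, i != ord0 -> `|w ord0 i| < L.
Proof.
move=> L0 psiL; elim: n b => [|n IH] b w /=.
  move=> /psiL wL; split=> //; have := wL ord0.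
  by rewrite ltr_norml expr0 => /andP[? ?]; apply/andP; split; lra.
have N1 : 1 <= 2 ^+ n :> R by rewrite exprn_ege1// ler1n.
rewrite exprS; have [f0|/IH[/andP[w1 w2] w3] _] := eqVneq (rs_symbol psi (2 * L) n false w) 0.
  rewrite f0 add0r mulf_eq0 negb_or => /andP[_ /IH[]].
  rewrite !mxE eqxx mulr1 => /andP[w1 w2] w3; split.
    have ? := mulr_gt0 L0 (lt_le_trans ltr01 N1).
    by apply/andP; split; lra.
  by move=> i i0; have := w3 i i0; rewrite !mxE (negbTE i0) mulr0 subr0.
split=> //; have ? := mulr_gt0 L0 (lt_le_trans ltr01 N1).
by apply/andP; split; lra.
Qed.

Lemma rs_symbol_le psi L M n b : 0 < L ->
  (forall w, psi w != 0 -> forall i, `|w ord0 i| < L) ->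
  (forall w, `|psi w| <= M) -> forall w, `|rs_symbol psi (2 * L) n b w| <= M.
Proof.
move=> L0 psiL psiM; elim: n b => [//|n IH] b w /=.
have sg : `|(-1) ^+ b : R| = 1 by rewrite normrX normrN1 expr1n.
have [->|f0] := eqVneq (rs_symbol psi (2 * L) n false w) 0.
  by rewrite add0r normrM sg mul1r.
have [->|t0] := eqVneq (rs_symbol psi (2 * L) n true
    (w - (2 * L * 2 ^+ n) *: e0)) 0.
  by rewrite mulr0 addr0.
(* If both halves were nonzero at [w], its first coordinate would lie on both sides of
   [2 * L * 2 ^+ n - L]. *)
have [/andP[_ w1] _] := rs_symbol_supp L0 psiL f0.
have [/andP[+ _] _] := rs_symbol_supp L0 psiL t0.
rewrite !mxE eqxx mulr1; lra.
Qed.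

Lemma measurable_dotV u : measurable_fun setT (fun w : V => dotV w u).
Proof.
rewrite /dotV; apply: measurable_sum => i.
by apply: measurable_funM => //; exact: (measurable_coord (T := R)).
Qed.

Lemma Cbmeas_expi dd (T : measurableType dd) (g : T -> R) :
  measurable_fun setT g -> Cbmeas (fun x => expi (g x)).
Proof.
move=> mg; split; split.
- exact: (measurableT_comp (continuous_measurable_fun (@continuous_cos R)) mg).
- by exists 1 => x; exact: cos_max.
- exact: (measurableT_comp (continuous_measurable_fun (@continuous_sin R)) mg).
- by exists 1 => x; exact: sin_max.
Qed.

Lemma Cbsupp_real dd (T : measurableType dd) (mu : {measure set T -> \bar R})
  (f : T -> R) : bsupp mu f -> Cbsupp mu (fun x => (f x)%:C).
Proof.
move=> bf; split=> //=; split; first exact: bmeas_cst.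
by exists set0; rewrite measure0; split.
Qed.

Lemma rs_symbol_fourier psi lam n b u : bsupp leb psi ->
  Cintegral leb (fun w => (rs_symbol psi lam n b w)%:C * expi (2 * pi * dotV w u)) =
  Cintegral leb (fun w => (psi w)%:C * expi (2 * pi * dotV w u)) *
  rs lam n b (u ord0 ord0).
Proof.
move=> bpsi.
have ce : Cbmeas (fun w => expi (2 * pi * dotV w u)).
  by apply: Cbmeas_expi; apply: measurable_funM => //; exact: measurable_dotV.
elim: n b => [|n IH] b; first by rewrite mulr1.
set c := (lam * 2 ^+ n) *: e0.
have dc : dotV c u = lam * 2 ^+ n * u ord0 ord0.
  rewrite /dotV (bigD1 ord0)//= big1 ?addr0; last first.
    by move=> i i0; rewrite !mxE (negbTE i0) mulr0 mul0r.
  by rewrite !mxE eqxx mulr1.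
have bsy n' b' : Cbsupp leb (fun w => (rs_symbol psi lam n' b' w)%:C *
    expi (2 * pi * dotV w u)).
  by apply: CbsuppMl => //; exact/Cbsupp_real/bsupp_rs_symbol.
under eq_Cintegral => w.
  rewrite (_ : _ * _ = (rs_symbol psi lam n false w)%:C * expi (2 * pi * dotV w u) +
    ((-1) ^+ b * expi (2 * pi * dotV c u)) *
    ((rs_symbol psi lam n true (w - c))%:C * expi (2 * pi * dotV (w - c) u))).
    over.
  have -> : dotV w u = dotV c u + dotV (w - c) u.
    rewrite /dotV -big_split/=; apply: eq_bigr => i _.
    by rewrite -mulrDl !mxE; congr (_ * _); ring.
  rewrite mulrDr expiD /= rmorphD rmorphM rmorphXn rmorphN rmorph1.
  ring.
rewrite CintegralD//; last first.
  by apply: CbsuppMr; [exact: Cbmeas_cst|exact: (Cbsupp_shift c (bsy n true))].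
rewrite CintegralZ; last exact: (Cbsupp_shift c (bsy n true)).
rewrite (Cintegral_shift_rV c (bsy n true)) !IH dc /=.
ring.
Qed.

End rudin_shapiro_symbol.

(** * The kernel of the operator for a tensor product symbol *)

Section locop_tensor.
Context (R : realType) (d : nat).
Local Notation V := 'rV[R]_d.
Local Notation leb := (lebesgue_rV R d).

Lemma Cbmeas_comp d1 d2 (T1 : measurableType d1) (T2 : measurableType d2)
  (F : T2 -> R[i]) (m : T1 -> T2) : measurable_fun setT m ->
  Cbmeas F -> Cbmeas (fun x => F (m x)).
Proof.
move=> mm [[F1 [M1 FM1]] [F2 [M2 FM2]]]; split; split.
- exact: (measurableT_comp F1 mm).
- by exists M1.
- exact: (measurableT_comp F2 mm).
- by exists M2.
Qed.

Lemma measurable_sub_rV dd (T : measurableType dd) (m1 m2 : T -> V) :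
  measurable_fun setT m1 -> measurable_fun setT m2 ->
  measurable_fun setT (fun x => m1 x - m2 x).
Proof.
move=> mm1 mm2; apply: measurable_fun_rVP => i.
under eq_fun do rewrite !mxE.
by apply: measurable_funB; exact: (measurableT_comp (measurable_coord (T := R) i)).
Qed.

Lemma Cbmeas_sub_rV dd (T : measurableType dd) (phi : V -> R[i]) (m1 m2 : T -> V) :
  Cbmeas phi -> measurable_fun setT m1 -> measurable_fun setT m2 ->
  Cbmeas (fun x => phi (m1 x - m2 x)).
Proof.
by move=> bphi mm1 mm2; exact: (Cbmeas_comp (measurable_sub_rV mm1 mm2) bphi).
Qed.

Lemma measurable_dotV2 dd (T : measurableType dd) (m1 m2 : T -> V) :
  measurable_fun setT m1 -> measurable_fun setT m2 ->
  measurable_fun setT (fun x => dotV (m1 x) (m2 x)).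
Proof.
move=> mm1 mm2; rewrite /dotV; apply: measurable_sum => i.
by apply: measurable_funM; exact: (measurableT_comp (measurable_coord (T := R) i)).
Qed.

Lemma dotVBr (w s t : V) : dotV w (t - s) = dotV w t - dotV w s.
Proof.
by rewrite /dotV -sumrB; apply: eq_bigr => i _; rewrite !mxE mulrBr.
Qed.

(* The Schwartz kernel of the localization operator with symbol
   [alpha (x) * beta (w)] is the inverse Fourier transform of [beta] at [t - s]
   times the integral of [alpha] against the two translated windows. *)
Lemma locop_tensor (phi1 phi2 f g : V -> R[i]) (alpha beta : V -> R[i]) :
  Cbmeas phi1 -> Cbmeas phi2 -> Cbsupp leb f -> Cbsupp leb g ->
  Cbsupp leb alpha -> Cbsupp leb beta ->
  let G p := f p.1 * conjc (g p.2) *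
    (Cintegral leb (fun x => alpha x * (conjc (phi1 (p.1 - x)) * phi2 (p.2 - x))) *
     Cintegral leb (fun w => beta w * expi (2 * pi * dotV w (p.2 - p.1)))) in
  locop (fun z => alpha z.1 * beta z.2) phi1 phi2 f g =
    Cintegral (leb \x leb)%E G /\
  (leb \x leb)%E.-integrable setT (EFin \o (fun p => complex.Re (G p))).
Proof.
move=> b1 b2 bf bg ba bb G.
pose K (phi h : V -> R[i]) (x w t : V) : R[i] :=
  h t * conjc (phi (t - x)) * expi (- (2 * pi * dotV w t)).
pose H (q : (V * V) * (V * V)) : R[i] := alpha q.1.1 * beta q.1.2 *
  (K phi1 f q.1.1 q.1.2 q.2.1 * conjc (K phi2 g q.1.1 q.1.2 q.2.2)).
have mcst (c : V) : measurable_fun setT (fun _ : V => c) by exact: measurable_cst.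
have mid : measurable_fun setT (fun x : V => x) by exact: measurable_id.
have bK (phi h : V -> R[i]) (x w : V) : Cbmeas phi -> Cbsupp leb h -> Cbsupp leb (K phi h x w).
  move=> bphi bh; apply: CbsuppMl; first apply: CbsuppMl => //.
    exact: Cbmeas_conj (Cbmeas_sub_rV bphi mid (mcst x)).
  apply: Cbmeas_expi; apply: measurableT_comp => //; apply: measurable_funM => //.
  by apply: measurable_dotV2 => //; exact: measurable_id.
have -> : locop (fun z => alpha z.1 * beta z.2) phi1 phi2 f g =
    Cintegral (leb \x leb)%E (fun z => Cintegral (leb \x leb)%E (fun p => H (z, p))).
  apply: eq_Cintegral => -[x w]; rewrite /H /=.
  rewrite CintegralZ; last first.
    exact: (CbsuppX (bK _ _ x w b1 bf) (Cbsupp_conj (bK _ _ x w b2 bg))).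
  rewrite -mulrA; congr (_ * _).
  apply/esym; apply: etrans
    (Cintegral_prodM (bK _ _ x w b1 bf) (Cbsupp_conj (bK _ _ x w b2 bg))) _.
  by rewrite Cintegral_conj//; exact: bK.
pose leb2 : {sigma_finite_measure set (V * V)%type -> \bar R} := sfprod leb leb.
have bH : Cbsupp (leb2 \x leb2)%E H.
  (* Regrouped so that the four functions with support of finite measure come first, followed by the
     bounded windows and phases. *)
  rewrite (_ : H = fun q => ((alpha q.1.1 * beta q.1.2) * (f q.2.1 * conjc (g q.2.2))) *
    ((conjc (phi1 (q.2.1 - q.1.1)) * expi (- (2 * pi * dotV q.1.2 q.2.1))) *
     conjc (conjc (phi2 (q.2.2 - q.1.1)) * expi (- (2 * pi * dotV q.1.2 q.2.2)))));
    last first.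
    by apply/funext => q; rewrite /H /K !rmorphM /=; ring.
  apply: CbsuppMl.
    exact: (@CbsuppX _ _ _ _ R leb2 leb2 (fun p => alpha p.1 * beta p.2)
      (fun p => f p.1 * conjc (g p.2)) (CbsuppX ba bb) (CbsuppX bf (Cbsupp_conj bg))).
  have m11 : measurable_fun setT (fun q : (V * V) * (V * V) => q.1.1).
    exact: (measurableT_comp measurable_fst measurable_fst).
  have m12 : measurable_fun setT (fun q : (V * V) * (V * V) => q.1.2).
    exact: (measurableT_comp measurable_snd measurable_fst).
  have m21 : measurable_fun setT (fun q : (V * V) * (V * V) => q.2.1).
    exact: (measurableT_comp measurable_fst measurable_snd).
  have m22 : measurable_fun setT (fun q : (V * V) * (V * V) => q.2.2).
    exact: (measurableT_comp measurable_snd measurable_snd).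
  have bw (phi : V -> R[i]) (m : (V * V) * (V * V) -> V) : Cbmeas phi ->
      measurable_fun setT m ->
      Cbmeas (fun q => conjc (phi (m q - q.1.1)) * expi (- (2 * pi * dotV q.1.2 (m q)))).
    move=> bphi mm; apply: CbmeasM.
      exact: Cbmeas_conj (Cbmeas_sub_rV bphi mm m11).
    apply: Cbmeas_expi; apply: measurableT_comp => //; apply: measurable_funM => //.
    exact: measurable_dotV2.
  exact: CbmeasM (bw phi1 _ b1 m21) (Cbmeas_conj (bw phi2 _ b2 m22)).
suff GE p : Cintegral (leb \x leb)%E (fun z => H (z, p)) = G p.
  split; first by apply: etrans (Cintegral_swap bH) _; exact: eq_Cintegral.
  have := integrable_Re_Cintegral bH.
  by apply: eq_integrable => // p _; congr ((complex.Re _)%:E); exact: GE.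
case: p => s t; rewrite /G /=.
have bA : Cbsupp leb (fun x => alpha x * (conjc (phi1 (s - x)) * phi2 (t - x))).
  apply: CbsuppMl => //; apply: CbmeasM.
    exact: Cbmeas_conj (Cbmeas_sub_rV b1 (mcst s) mid).
  exact: Cbmeas_sub_rV b2 (mcst t) mid.
have bB : Cbsupp leb (fun w => beta w * expi (2 * pi * dotV w (t - s))).
  apply: CbsuppMl => //; apply: Cbmeas_expi; apply: measurable_funM => //.
  by apply: measurable_dotV2 => //; exact: measurable_id.
rewrite -(Cintegral_prodM bA bB) -CintegralZ; last exact: (CbsuppX bA bB).
apply: eq_Cintegral => -[x w].
have cM (a b : R[i]) : conjc (a * b) = conjc a * conjc b by exact: rmorphM.
have -> : H ((x, w), (s, t)) = alpha x * beta w * (K phi1 f x w s * conjc (K phi2 g x w t)).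
  by [].
rewrite /K !cM conjcK conjc_expi opprK dotVBr mulrBr expiD.
rewrite [(x, w).1]/= [(x, w).2]/=.
ring.
Qed.

End locop_tensor.
(** * L^p estimates *)

Section Lp_estimates.
Context dd (T : measurableType dd) (R : realType).
Variable mu : {measure set T -> \bar R}.
Local Notation normc := ComplexField.Normc.normc.
Implicit Types (f g h : T -> R[i]) (p : \bar R) (E : set T).

Definition Cmeas f := measurable_fun setT (fun x => complex.Re (f x)) /\
                      measurable_fun setT (fun x => complex.Im (f x)).

(* Equal to [0] for [p = +oo]. *)
Definition expo p : R := fine p^-1.

Lemma expo_ge0 p : (1 <= p)%E -> 0 <= expo p.
Proof. by move=> p1; rewrite fine_ge0// inve_ge0 (le_trans _ p1). Qed.

Lemma expoE p : (1 <= p)%E -> (p^-1 = (expo p)%:E)%E.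
Proof.
rewrite /expo; case: p => [r|_|//]; last by rewrite invey.
rewrite lee_fin => r1; have r0 : 0 < r by exact: lt_le_trans r1.
by rewrite inver gt_eqF.
Qed.

Lemma measurable_normc f : Cmeas f -> measurable_fun setT (fun x => normc (f x)).
Proof.
move=> [f1 f2].
have -> : (fun x => normc (f x)) =
    (fun x => Num.sqrt (complex.Re (f x) ^+ 2 + complex.Im (f x) ^+ 2)).
  by apply/funext => x; case: (f x).
apply: (measurableT_comp (continuous_measurable_fun (@sqrt_continuous R))).
by apply: measurable_funD; exact: measurable_funX.
Qed.

Lemma Lnorm_le p (u : T -> R) E (M v : R) : (1 <= p)%E ->
  measurable_fun setT u -> measurable E ->
  (mu E <= v%:E)%E -> 0 <= v -> 0 <= M -> (forall x, `|u x| <= M) ->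
  (forall x, ~ E x -> u x = 0) ->
  (Lnorm mu p (EFin \o u) <= (M * v `^ expo p)%:E)%E.
Proof.
move=> p1 mu_ mE Ev v0 M0 uM uE.
(* At [+oo] the exponent of [v] is 0 and the power is 1, even for [v = 0]. *)
case: p p1 => [r|_|//]; last first.
  rewrite /expo invey /= powRr0 mulr1 unlock /Lnorm; case: ifPn => // mu0.
  by apply/ess_supP; apply: nearW => x /=; rewrite lee_fin.
rewrite lee_fin => r1; have r0 : 0 < r by exact: lt_le_trans r1.
rewrite /expo inver gt_eqF//= unlock /Lnorm.
have -> : (M * v `^ r^-1)%:E = ((M `^ r * v)%:E `^ r^-1)%E.
  rewrite poweR_EFin powRM// ?powR_ge0// -powRrM mulfV ?gt_eqF// powRr1//.
have mF : measurable_fun setT (fun x => (`|(EFin \o u) x| `^ r)%E).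
  apply: (measurableT_comp (measurable_poweR r)).
  by apply: measurableT_comp => //; exact/measurable_EFinP.
apply: gt0_ler_poweR; rewrite ?invr_ge0 ?(ltW r0)//.
- by rewrite in_itv /= leey andbT; exact: integral_ge0.
- by rewrite in_itv /= leey andbT lee_fin mulr_ge0 ?powR_ge0.
apply: (@le_trans _ _ (\int[mu]_x ((cst (M `^ r)%:E) \_ E) x)%E).
  apply: ge0_le_integral => //.
  - by move=> x _; exact: poweR_ge0.
  - by apply/(measurable_restrictT _ mE); exact: measurable_cst.
  - move=> x _; rewrite patchE; case: ifPn => [_|].
      by rewrite /= lee_fin; apply: ge0_ler_powR; rewrite ?nnegrE// ltW.
    by rewrite notin_setE => /uE /= ->; rewrite normr0 powR0// gt_eqF.
rewrite -integral_mkcond integral_cst// EFinM.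
by apply: lee_wpmul2l => //; rewrite lee_fin powR_ge0.
Qed.

Lemma CLnorm_le p f E (M v : R) : (1 <= p)%E -> Cmeas f -> measurable E ->
  (mu E <= v%:E)%E -> 0 <= v -> 0 <= M -> (forall x, normc (f x) <= M) ->
  (forall x, ~ E x -> f x = 0) -> (CLnorm mu p f <= (M * v `^ expo p)%:E)%E.
Proof.
move=> p1 mf mE Ev v0 M0 fM fE.
apply: (@Lnorm_le p (fun x => normc (f x)) E M v) => //.
- exact: measurable_normc.
- by move=> x; rewrite ger0_norm// normc_ge0.
- by move=> x /fE ->; rewrite normc_zero.
Qed.

(** Hölder against the indicator of [E]. Both exponents are finite only for 1 < p < +oo; at [+oo]
    the essential supremum bounds the integrand, and at 1 the power of [v] is 1. *)
Lemma integral_le_Lnorm p h E (v : R) : (1 <= p)%E -> Cmeas h -> measurable E ->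
  (mu E <= v%:E)%E -> 0 <= v ->
  (\int[mu]_(x in E) (normc (h x))%:E <= CLnorm mu p h * (v `^ (1 - expo p))%:E)%E.
Proof.
move=> p1 mh mE Ev v0.
have mn := measurable_normc mh.
have men : measurable_fun setT (fun x => (normc (h x))%:E) by exact/measurable_EFinP.
have L0 := Lnorm_ge0 mu p (fun x => (normc (h x))%:E).
case: p p1 L0 => [r|_ L0|//]; last first.
  rewrite /expo invey /= subr0 powRr1//.
  (* On a space of measure 0 the norm for [+oo] is 0 by definition, so this case is separate; the
     integral vanishes as well. *)
  have [mu0|] := ltP 0%E (mu setT); last first.
    move=> muT; rewrite null_set_integral//; last 2 first.
    - exact: measurable_funTS.
    - apply/eqP; rewrite eq_le measure_ge0 andbT.
      by apply: le_trans muT; exact: le_measure (mem_set mE) (mem_set measurableT) (subsetT _).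
    by rewrite mule_ge0.
  apply: (@le_trans _ _ (\int[mu]_(x in E) (cst (CLnorm mu +oo h)) x)%E).
    apply: ae_ge0_le_integral => //.
    - by move=> x _; rewrite lee_fin normc_ge0.
    - exact: measurable_funTS.
    rewrite /CLnorm unlock /Lnorm mu0.
    have := ess_sup_ge mu (abse \o (fun x => (normc (h x))%:E)).
    apply: filterS => x /= hx _; apply: le_trans hx.
    by rewrite lee_fin ger0_norm ?normc_ge0.
  by rewrite integral_cst//; exact: lee_wpmul2l.
rewrite lee_fin le_eqVlt => /predU1P[<- L0|r1 L0].
  rewrite /expo inve1 /= subrr powRr0 mule1 /CLnorm Lnorm1.
  apply: (@le_trans _ _ (\int[mu]_(x in E) `|(normc (h x))%:E|)%E).
    apply: ge0_le_integral => //.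
    - by move=> x _; rewrite lee_fin normc_ge0.
    - exact: measurable_funTS.
    - by apply: measurable_funTS; exact: measurableT_comp.
    - by move=> x _; rewrite lee_fin ler_norm.
  by apply: ge0_subset_integral => //; exact: measurableT_comp.
have r0 : 0 < r by exact: lt_trans r1.
rewrite /expo inver gt_eqF//=.
pose q := (1 - r^-1)^-1.
have q1 : 0 < 1 - r^-1 by rewrite subr_gt0 invf_lt1.
have q0 : 0 < q by rewrite invr_gt0.
have := @hoelder _ T R mu (fun x => normc (h x)) (\1_E) r q mn
  (measurable_indic mE) r0 q0 _.
rewrite /q invrK addrC subrK => /(_ erefl) H.
have qge1 : (1 <= q%:E)%E.
  by rewrite lee_fin /q invf_ge1// lerBlDr lerDl invr_ge0 ltW.
have Nq : (Lnorm mu q%:E (EFin \o (\1_E : T -> R)) <= (v `^ (1 - r^-1))%:E)%E.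
  rewrite -[leRHS]mul1e -EFinM -(_ : expo q%:E = 1 - r^-1); last first.
    by rewrite /expo inver gt_eqF//= /q invrK.
  apply: (Lnorm_le (E := E)) => //.
    by move=> x; rewrite indicE ger0_norm// lern1 leq_b1.
  by move=> x nEx; rewrite indicE memNset.
apply: le_trans (lee_wpmul2l L0 Nq).
apply: le_trans H; rewrite Lnorm1 integral_mkcond le_eqVlt; apply/orP; left.
apply/eqP; apply: eq_integral => x _; rewrite patchE /= indicE.
case: ifPn => [xE|_]; last by rewrite mulr0 normr0.
by rewrite mulr1 ger0_norm// normc_ge0.
Qed.

(** Measurability of the product is enough: if the integral is infinite, [fine] replaces it by 0,
    which only decreases the left-hand side. *)
Lemma Re_inner_le p h g E (G v : R) : (1 <= p)%E -> Cmeas h -> Cmeas g ->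
  measurable E -> (mu E <= v%:E)%E -> 0 <= v -> 0 <= G ->
  (forall x, normc (g x) <= G) -> (forall x, ~ E x -> g x = 0) ->
  (`|complex.Re (Cintegral mu (fun x => h x * conjc (g x)))|%:E <=
   G%:E * (CLnorm mu p h * (v `^ (1 - expo p))%:E))%E.
Proof.
move=> p1 mh mg mE Ev v0 G0 gG gE; rewrite /Cintegral /= /Rintegral.
set F := fun x => (complex.Re (h x * conjc (g x)))%:E.
have mF : measurable_fun setT F.
  apply/measurable_EFinP; under eq_fun do rewrite ReM.
  have -> : (fun x => complex.Re (h x) * complex.Re (conjc (g x)) -
      complex.Im (h x) * complex.Im (conjc (g x))) =
    (fun x => complex.Re (h x) * complex.Re (g x) + complex.Im (h x) * complex.Im (g x)).
    by apply/funext => x; case: (g x) => a b /=; rewrite mulrN opprK.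
  by case: mh mg => [? ?] [? ?]; apply: measurable_funD; exact: measurable_funM.
have fine_le (X : \bar R) : (`|fine X|%:E <= `|X|)%E.
  by case: X => [x| |] //=; rewrite normr0 leey.
apply: le_trans (fine_le _) _; apply: le_trans (le_abse_integral _ _ mF) _ => //.
have mn := measurable_normc mh.
apply: (@le_trans _ _ (\int[mu]_(x in E) (G%:E * (normc (h x))%:E))%E); last first.
  rewrite ge0_integralZl//.
  - by apply: lee_wpmul2l; [rewrite lee_fin|exact: integral_le_Lnorm].
  - by apply: measurable_funTS; exact/measurable_EFinP.
  - by move=> x _; rewrite lee_fin normc_ge0.
rewrite [leRHS]integral_mkcond; apply: ge0_le_integral => //.
- exact: measurableT_comp.
- apply/(measurable_restrictT _ mE); apply: measurable_funTS.
  by apply/measurable_EFinP; apply: measurable_funM => //; exact: measurable_cst.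
move=> x _; rewrite patchE /F; case: ifPn => [_|].
  rewrite -EFinM /= lee_fin; apply: le_trans (normr_Re _) _.
  rewrite ComplexField.Normc.normcM mulrC ler_wpM2r ?normc_ge0//.
  by case: (g x) (gG x) => a b /=; rewrite sqrrN.
by rewrite notin_setE => /gE -> /=; rewrite oppr0 mulr0 normr0.
Qed.

End Lp_estimates.
Section boxes.
Context (R : realType) (d : nat).
Local Notation V := 'rV[R]_d.+1.
Local Notation leb := (lebesgue_rV R d.+1).

Definition slab (c : V) (a b : R) : set V :=
  [set x | forall i, `|x ord0 i - c ord0 i| < if i == ord0 then a else b].

Let side (c : V) (a b : R) (i : 'I_d.+1) : set (measurableTypeR R) :=
  ball (c ord0 i : R) (if i == ord0 then a else b).

Lemma measurable_side c a b i : measurable (side c a b i).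
Proof. exact: open_measurable (ball_open _ _). Qed.

Lemma slabE c a b : slab c a b = [set x | forall i, side c a b i (x ord0 i)].
Proof.
by apply/seteqP; split=> x xA i; have := xA i; rewrite /side /ball /= distrC.
Qed.

Lemma measurable_slab c a b : measurable (slab c a b).
Proof.
rewrite slabE [X in measurable X](_ : _ = \bigcap_(i in [set: 'I_d.+1])
    ((fun x : V => x ord0 i) @^-1` (side c a b i))).
  apply: fin_bigcap_measurable => [|i _]; first exact: finite_finset.
  rewrite -[X in measurable X]setTI; apply: (measurable_coord (T := R)) => //.
  exact: measurable_side.
by apply/seteqP; split=> [x xA i _|x xA i]; [exact: xA|exact: (xA i)].
Qed.

Lemma lebesgue_slab c a b : 0 < a -> 0 < b ->
  leb (slab c a b) = (2 * a * (2 * b) ^+ d)%:E.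
Proof.
move=> a0 b0; rewrite slabE; have mS := measurable_side c a b.
apply: etrans (lebesgue_rV_box mS) _.
have sideE i : lebesgue_measure (side c a b i) = (2 * if i == ord0 then a else b)%:E.
  by rewrite lebesgue_measure_ball ?mulr_natl//; case: ifP => _; exact: ltW.
under eq_bigr do rewrite sideE.
rewrite -(big_morph EFin (fun x y => EFinM x y) erefl); congr EFin.
by rewrite big_ord_recl eqxx /= prodr_const card_ord.
Qed.

Lemma lebesgue_slab_fin c a b : 0 < a -> 0 < b -> (leb (slab c a b) < +oo)%E.
Proof. by move=> a0 b0; rewrite lebesgue_slab// ltry. Qed.

End boxes.

Section integral_lower_bound.
Context dd (T : measurableType dd) (R : realType).
Variable mu : {measure set T -> \bar R}.

Lemma Rintegral_ge (F : T -> R) (E : set T) (c : R) :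
  0 <= c -> mu.-integrable setT (EFin \o F) -> measurable E -> (mu E < +oo)%E ->
  (forall x, 0 <= F x) -> (forall x, E x -> c <= F x) ->
  c * fine (mu E) <= \int[mu]_x F x.
Proof.
move=> c0 iF mE Eoo F0 FE; have mF := measurable_int _ iF.
rewrite -lee_fin EFinM fineK ?ge0_fin_numE//.
rewrite fineK; last exact: integrable_fin_num.
apply: (@le_trans _ _ (\int[mu]_(x in E) (F x)%:E)%E).
  rewrite -integral_cst//; apply: ge0_le_integral => //.
  - exact: measurable_funTS.
by apply: ge0_subset_integral => // x _; rewrite lee_fin.
Qed.

Lemma Cintegral_real (F : T -> R) :
  Cintegral mu (fun x => (F x)%:C) = (\int[mu]_x F x)%:C.
Proof. by rewrite /Cintegral /= Rintegral_cst//= mul0r. Qed.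

End integral_lower_bound.

(** * Windows and test functions *)

Section windows.
Context (R : realType) (d : nat).
Local Notation V := 'rV[R]_d.+1.
Local Notation leb := (lebesgue_rV R d.+1).

(** Quantitative data of a window. As [L] and [M] may be enlarged and [k] shrunk, one triple serves
    the two windows and the bump at once; [window_near] keeps what is used of the value 1 at the
    origin. *)
Record window (L M k : R) (u : V -> R) : Prop := Window {
  window_smooth : smooth u;
  window_csupp : csupp u;
  window_ge0 : forall t, 0 <= u t;
  window_le : forall t, u t <= M;
  window_supp : forall t : V, u t != 0 -> forall i, `|t ord0 i| < L;
  window_near : forall t : V, (forall i, `|t ord0 i| < k) -> 2^-1 <= u t }.

Lemma window_exists u : smooth u -> csupp u -> (forall t, 0 <= u t) -> u 0 = 1 ->
  exists L M k, 0 < k /\ window L M k u.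
Proof.
move=> su cu u0 u01; have cont := smooth_continuous su.
have [M uM] := csupp_bounded cont cu.
have [K cK uK] := cu.
have [L [_ KL]] := compact_bounded cK.
have : \forall t \near (0 : V), 2^-1 < u t.
  have /cvgr_gt : u x @[x --> (0 : V)] --> u 0 by exact: cont.
  by apply; rewrite u01 invf_lt1// ltr1n.
move=> /nbhs_ballP[k /= k0 uk].
(* One unit gives a bound valid on [K], the second makes the inequality strict. *)
exists (Num.max 0 L + 2), M, k; split => //; split=> //.
- by move=> t; apply: le_trans (ler_norm _) (uM t).
- move=> t ut i; have Kt : K t by apply: contrapT => /uK/eqP; rewrite (negbTE ut).
  have tL : `|t| <= Num.max 0 L + 1.
    by apply: KL Kt; rewrite ltr_pwDr// le_max lexx orbT.
  apply: (@le_lt_trans _ _ `|t|); last by lra.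
  have -> : `|t| = \big[Num.max/0]_ij `|t ij.1 ij.2| by exact: mx_normrE.
  exact: (le_bigmax _ (fun ij => `|t ij.1 ij.2|) (ord0, i)).
- move=> t tk; apply: ltW; apply: uk; split=> // i j.
  by rewrite !ord1 /ball /= mxE sub0r normrN.
Qed.

Lemma window_weaken L M k L' M' k' u : L <= L' -> M <= M' -> k' <= k ->
  window L M k u -> window L' M' k' u.
Proof.
move=> LL MM kk [su cu u0 uM uL uk]; split=> //.
- by move=> t; exact: le_trans MM.
- by move=> t ut i; exact: lt_le_trans (uL t ut i) LL.
- by move=> t tk; apply: uk => i; exact: lt_le_trans (tk i) kk.
Qed.

Lemma window_bmeas L M k u : window L M k u -> bmeas u.
Proof.
move=> [su cu u0 uM _ _]; split; first by apply: continuous_measurable_rV; exact: smooth_continuous.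
by exists M => x; rewrite ger0_norm.
Qed.

Lemma window_bsupp L M k u : 0 < L -> window L M k u -> bsupp leb u.
Proof.
move=> L0 Wu; split; first exact: window_bmeas Wu.
exists (slab 0 L L); split; first exact: measurable_slab.
  exact: lebesgue_slab_fin.
move=> x nx; apply/eqP; apply: contrapT => /negP ux; apply: nx => i.
by rewrite mxE subr0; case: ifP => _; exact: (window_supp Wu).
Qed.

End windows.
Section diagonal_scaling.
Context (R : realType) (n : nat).
Local Notation V := 'rV[R]_n.

Definition scale_rV (c : 'I_n -> R) (x : V) : V := \row_i (c i * x ord0 i).

Lemma scale_rV_affine c (h : R) (v x : V) :
  scale_rV c (h *: v + x) = h *: scale_rV c v + scale_rV c x.
Proof. by apply/rowP => i; rewrite !mxE; ring. Qed.

Lemma scale_rVK c : (forall i, c i != 0) ->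
  cancel (scale_rV c) (scale_rV (fun i => (c i)^-1)).
Proof. by move=> c0 x; apply/rowP => i; rewrite !mxE mulKf. Qed.

Lemma continuous_scale_rV c : continuous (scale_rV c).
Proof.
move=> x A /nbhs_ballP[e /= e0 eA].
pose C := \sum_i `|c i| + 1.
have C0 : 0 < C by rewrite ltr_wpDl// sumr_ge0.
apply/nbhs_ballP; exists (e / C) => /=; first exact: divr_gt0.
move=> z [_ xz]; apply: eA; split=> // i j; rewrite !ord1.
have := xz ord0 j; rewrite /ball /= !mxE -mulrBr normrM ltr_pdivlMr// mulrC.
apply: le_lt_trans; apply: ler_wpM2r => //.
by rewrite /C (bigD1 j)//= -addrA lerDl addr_ge0// sumr_ge0.
Qed.

Lemma smooth_scale_rV c (u : V -> R) : smooth u -> smooth (fun x => u (scale_rV c x)).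
Proof.
apply: (@smooth_comp_affine _ _ _ (scale_rV c) (scale_rV c)).
  exact: continuous_scale_rV.
exact: scale_rV_affine.
Qed.

Lemma csupp_scale_rV c (u : V -> R) : (forall i, c i != 0) ->
  csupp u -> csupp (fun x => u (scale_rV c x)).
Proof.
move=> c0; apply: (@csupp_comp _ _ _ (scale_rV c) (scale_rV (fun i => (c i)^-1))).
  exact: continuous_scale_rV.
exact: scale_rVK.
Qed.

End diagonal_scaling.

Section perturbation.
Context (R : realType).
Local Notation normc := ComplexField.Normc.normc.

Lemma normc_conjc (z : R[i]) : normc (conjc z) = normc z.
Proof. by case: z => a b /=; rewrite sqrrN. Qed.

Lemma ReD (z w : R[i]) : complex.Re (z + w) = complex.Re z + complex.Re w.
Proof. by case: z => a b; case: w. Qed.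

(** In the application [p] is the Rudin-Shapiro value in the flat function, [p'] the one in the
    kernel, and [w] the inverse Fourier transform of the bump, close to its mass [c0]. The error
    terms come from replacing [w] by [c0] and [p'] by [p]. *)
Lemma Re_conj_mul_ge (c0 e B D : R) (p p' w : R[i]) :
  0 <= c0 -> normc p <= B -> normc p' <= B -> normc (p' - p) <= D ->
  normc (w - c0%:C) <= e ->
  c0 * normc p ^+ 2 - (e * B ^+ 2 + c0 * (B * D)) <=
    complex.Re (conjc p * (w * p')).
Proof.
move=> c00 pB p'B pD we.
have n0 := @normc_ge0 R.
have -> : conjc p * (w * p') = c0%:C * (p * conjc p) +
    ((w - c0%:C) * (conjc p * p') + c0%:C * (conjc p * (p' - p))) by ring.
rewrite ReD; apply: lerD.
  rewrite sqr_normc_ReIm; case: p {pB pD} => a b /=; rewrite le_eqVlt.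
  by apply/orP; left; apply/eqP; ring.
rewrite -lerN2 opprK; apply: (@le_trans _ _ (normc ((w - c0%:C) * (conjc p * p') +
    c0%:C * (conjc p * (p' - p))))).
  by apply: le_trans (normr_Re _); rewrite -normrN ler_norm.
apply: le_trans (le_normcD _ _) _; rewrite !ComplexField.Normc.normcM normc_conjc.
rewrite normc_real ger0_norm//; apply: lerD.
  apply: ler_pM => //; first by rewrite mulr_ge0.
  by rewrite expr2; apply: ler_pM.
by apply: ler_wpM2l => //; apply: ler_pM.
Qed.

End perturbation.

Section test_functions.
Context (R : realType) (d : nat).
Local Notation V := 'rV[R]_d.+1.
Local Notation leb := (lebesgue_rV R d.+1).
Local Notation normc := ComplexField.Normc.normc.
Variables (L M k : R) (u : V -> R).
Hypotheses (L1 : 1 <= L) (k0 : 0 < k).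
Hypothesis (Wu : window L M k u).
Implicit Types (y s t x w : V) (n : nat) (b : bool).

(* Large enough for the phases and for the variation of the Rudin-Shapiro
   polynomials to be negligible on the supports of the test functions. *)
Definition dilation : R := 960 * d.+1%:R * L ^+ 2.

Local Notation K := dilation.

Let L0 : 0 < L. Proof. exact: lt_le_trans L1. Qed.

Lemma dilation_ge1 : 1 <= K.
Proof.
have d1 : 1 <= d.+1%:R :> R by rewrite ler1n.
have L2 : 1 <= L ^+ 2 by rewrite exprn_ege1.
by rewrite /K; have := ler_pM ler01 ler01 d1 L2; rewrite mulr1; lra.
Qed.

Let K0 : 0 < K. Proof. exact: lt_le_trans dilation_ge1. Qed.

(** The spike at scale N = 2^n: shrunk by [K] in every direction and by N more in the first.
    [bump 0] is the envelope of the flat function. *)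
Definition bump n y s : R :=
  u (scale_rV (fun i => K * (if i == ord0 then 2 ^+ n else 1)) (s - y)).

(** The modulation is centred at [y] because the kernel depends on [t - s] and the first coordinate
    of [s] stays within order 1/N of that of [y] on the spike. *)
Definition flat n b y t : R[i] :=
  (bump 0 y t)%:C * rs (2 * L) n b (t ord0 ord0 - y ord0 ord0).

Definition rsymb n b : V -> R := rs_symbol u (2 * L) n b.

Let dil_neq0 n (i : 'I_d.+1) : K * (if i == ord0 then 2 ^+ n else 1) != 0.
Proof.
apply: mulf_neq0; first by rewrite gt_eqF.
by case: ifP => _; rewrite ?oner_eq0// gt_eqF// exprn_gt0.
Qed.

Lemma smooth_bump n y : smooth (bump n y).
Proof. exact: (smooth_shift y (smooth_scale_rV _ (window_smooth Wu))). Qed.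

Lemma csupp_bump n y : csupp (bump n y).
Proof.
exact: (csupp_shift y (csupp_scale_rV (dil_neq0 n) (window_csupp Wu))).
Qed.

Lemma bump_ge0 n y s : 0 <= bump n y s.
Proof. exact: window_ge0 Wu _. Qed.

Lemma bump_le n y s : bump n y s <= M.
Proof. exact: window_le Wu _. Qed.

Lemma M_gt0 : 0 < M.
Proof.
have : 2^-1 <= u 0 by apply: (window_near Wu) => i; rewrite mxE normr0.
have := window_le Wu 0; have : 0 < 2^-1 :> R by rewrite invr_gt0.
lra.
Qed.

Lemma bump_supp n y s : bump n y s != 0 -> slab y (L / (K * 2 ^+ n)) (L / K) s.
Proof.
move=> /(window_supp Wu) sL i; have := sL i; rewrite !mxE normrM.
have KN : 0 < K * 2 ^+ n by rewrite mulr_gt0// exprn_gt0.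
case: ifP => _; last rewrite mulr1.
  by rewrite (gtr0_norm KN) ltr_pdivlMr// [X in _ -> X < _]mulrC.
by rewrite (gtr0_norm K0) ltr_pdivlMr// [X in _ -> X < _]mulrC.
Qed.

Lemma bump_near n y s : slab y (k / (K * 2 ^+ n)) (k / K) s -> 2^-1 <= bump n y s.
Proof.
move=> sk; apply: (window_near Wu) => i; have := sk i; rewrite !mxE normrM.
have KN : 0 < K * 2 ^+ n by rewrite mulr_gt0// exprn_gt0.
case: ifP => _; last rewrite mulr1.
  by rewrite (gtr0_norm KN) ltr_pdivlMr// [X in X < _ -> _]mulrC.
by rewrite (gtr0_norm K0) ltr_pdivlMr// [X in X < _ -> _]mulrC.
Qed.

Lemma slab_sub y (a a' b b' : R) : a <= a' -> b <= b' -> slab y a b `<=` slab y a' b'.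
Proof.
move=> aa bb x xa i; apply: lt_le_trans (xa i) _.
by case: ifP.
Qed.

Lemma bump_bsupp n y : bsupp leb (bump n y).
Proof.
have n0 : 0 < 2 ^+ n :> R by rewrite exprn_gt0.
split; [split|].
- by apply: continuous_measurable_rV; exact: smooth_continuous (smooth_bump n y).
- by exists M => x; rewrite ger0_norm ?bump_ge0// bump_le.
exists (slab y (L / (K * 2 ^+ n)) (L / K)); split.
- exact: measurable_slab.
- by apply: lebesgue_slab_fin; rewrite divr_gt0// mulr_gt0.
- move=> x nx; apply/eqP; apply: contrapT => /negP bx; apply: nx.
  exact: bump_supp.
Qed.

Lemma smooth_coord (h : R -> R) y : smooth h ->
  smooth (fun t : V => h (t ord0 ord0 - y ord0 ord0)).
Proof.
move=> sh; have s1 : smooth (fun t : V => h (t ord0 ord0)).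
  apply: (@smooth_comp_affine _ _ _ (fun t : V => t ord0 ord0)
    (fun t : V => t ord0 ord0) h) => //.
    exact: coord_continuous.
  by move=> c v x; rewrite !mxE.
have := smooth_shift y s1; congr smooth; apply/funext => t.
by rewrite !mxE.
Qed.

Lemma Re_flat n b y t : complex.Re (flat n b y t) =
  bump 0 y t * complex.Re (rs (2 * L) n b (t ord0 ord0 - y ord0 ord0)).
Proof. by rewrite /flat ReM /= mul0r subr0. Qed.

Lemma Im_flat n b y t : complex.Im (flat n b y t) =
  bump 0 y t * complex.Im (rs (2 * L) n b (t ord0 ord0 - y ord0 ord0)).
Proof. by rewrite /flat ImM /= mul0r addr0. Qed.

Lemma smooth_csupp_flat n b y :
  (smooth (fun t => complex.Re (flat n b y t)) /\
   csupp (fun t => complex.Re (flat n b y t))) /\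
  (smooth (fun t => complex.Im (flat n b y t)) /\
   csupp (fun t => complex.Im (flat n b y t))).
Proof.
have [sr si] := smooth_rs (2 * L) n b.
split; split.
- under eq_fun do rewrite Re_flat.
  exact: smoothM (smooth_bump 0 y) (smooth_coord y sr).
- under eq_fun do rewrite Re_flat.
  exact: csuppMl (csupp_bump 0 y).
- under eq_fun do rewrite Im_flat.
  exact: smoothM (smooth_bump 0 y) (smooth_coord y si).
- under eq_fun do rewrite Im_flat.
  exact: csuppMl (csupp_bump 0 y).
Qed.

Lemma normc_flat_le n b y t : normc (flat n b y t) <= M * Num.sqrt 2 ^+ n.+1.
Proof.
rewrite /flat ComplexField.Normc.normcM normc_real ger0_norm ?bump_ge0//.
by apply: ler_pM; rewrite ?bump_ge0 ?normc_ge0 ?bump_le ?normc_rs_le.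
Qed.

Lemma flat_supp n b y t : ~ slab y (L / K) (L / K) t -> flat n b y t = 0.
Proof.
move=> nt; rewrite /flat; have [->|/bump_supp] := eqVneq (bump 0 y t) 0.
  by rewrite mul0r.
by rewrite expr0 mulr1.
Qed.

Lemma flat_bsupp n b y : Cbsupp leb (flat n b y).
Proof.
have off t : ~ slab y (L / K) (L / K) t -> flat n b y t = 0 by exact: flat_supp.
have [[sr _] [si _]] := smooth_csupp_flat n b y.
have E : exists E, [/\ measurable E, (leb E < +oo)%E & forall t, ~ E t -> flat n b y t = 0].
  exists (slab y (L / K) (L / K)); split=> //; first exact: measurable_slab.
  by apply: lebesgue_slab_fin; rewrite divr_gt0.
have [E' [mE Eoo offE]] := E.
split; (split; [split|exists E'; split => // t /offE -> //]).
- by apply: continuous_measurable_rV; exact: smooth_continuous sr.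
- exists (M * Num.sqrt 2 ^+ n.+1) => t.
  exact: le_trans (normr_Re _) (normc_flat_le n b y t).
- by apply: continuous_measurable_rV; exact: smooth_continuous si.
- exists (M * Num.sqrt 2 ^+ n.+1) => t.
  exact: le_trans (normr_Im _) (normc_flat_le n b y t).
Qed.

Lemma rsymb_bsupp n b : bsupp leb (rsymb n b).
Proof. exact: bsupp_rs_symbol (window_bsupp L0 Wu). Qed.

Definition mass : R := \int[leb]_w u w.

Lemma mass_gt0 : 0 < mass.
Proof.
have sl : (leb (slab 0 k k) < +oo)%E by exact: lebesgue_slab_fin.
have := Rintegral_ge (E := slab 0 k k) (c := 2^-1) _
  (bsupp_integrable (window_bsupp L0 Wu)) (measurable_slab _ _ _) sl (window_ge0 Wu) _.
rewrite invr_ge0 ler0n => /(_ erefl) H; apply: lt_le_trans (H _); last first.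
  move=> x xk; apply: (window_near Wu) => i; have := xk i.
  by rewrite mxE subr0; case: ifP.
rewrite mulr_gt0// ?invr_gt0//.
have -> : fine (leb (slab 0 k k)) = 2 * k * (2 * k) ^+ d.
  by have := lebesgue_slab (0 : V) k0 k0 => /= ->.
by rewrite mulr_gt0 ?exprn_gt0// mulr_gt0.
Qed.

(** The box for [v] contains the differences [t - s] of points in the supports of the two test
    functions. There the phase is at most 1/16 on the support of [u], so the inverse Fourier
    transform is close to its value [mass] at 0; real and imaginary part cost [mass / 16] each. *)
Lemma window_fourier (v : V) : (forall i, `|v ord0 i| <= 2 * L / K) ->
  normc (Cintegral leb (fun w => (u w)%:C * expi (2 * pi * dotV w v)) - mass%:C) <=
  mass / 8.
Proof.
move=> vK; have bu := window_bsupp L0 Wu.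
have iu := bsupp_integrable bu.
have pi4 : pi <= 4 :> R by have := @pihalf_lt2 R; lra.
have pi0 := @pi_ge0 R.
have theta w : u w != 0 -> `|2 * pi * dotV w v| <= 16^-1.
  move=> /(window_supp Wu) wL.
  rewrite normrM ger0_norm ?mulr_ge0//.
  have dv : `|dotV w v| <= d.+1%:R * (L * (2 * L / K)).
    apply: le_trans (ler_norm_sum _ _ _) _.
    rewrite -[X in X%:R]card_ord -sum1_card natr_sum mulr_suml ler_sum// => i _.
    by rewrite mul1r normrM ler_pM// ltW.
  have tp : 0 <= 2 * pi :> R by rewrite mulr_ge0.
  apply: le_trans (ler_wpM2l tp dv) _.
  have -> : d.+1%:R * (L * (2 * L / K)) = 480^-1.
    have : d.+1%:R != 0 :> R by rewrite pnatr_eq0.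
    have : L != 0 by rewrite gt_eqF.
    by rewrite /K => ? ?; field; apply/andP.
  by lra.
have cE : Cbmeas (fun w => expi (2 * pi * dotV w v)).
  by apply: Cbmeas_expi; apply: measurable_funM => //; exact: measurable_dotV.
apply: le_trans (normc_le1norm _) _; rewrite !raddfB /=.
(* Used for the cosine with [c = 1] and for the sine with [c = 0]. *)
have key (g : V -> R) (c : R) : bmeas g -> (forall w, u w != 0 -> `|g w - c| <= 16^-1) ->
    `|\int[leb]_w (u w * g w) - c * mass| <= mass / 16.
  move=> bg gc.
  have bug := bsuppMl bu bg.
  have buc := bsuppMr (bmeas_cst _ c) bu.
  rewrite /mass -(RintegralZl c measurableT iu).
  rewrite -(RintegralB measurableT (bsupp_integrable bug) (bsupp_integrable buc)).
  apply: le_trans (le_normr_Rintegral _ _) _ => //.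
    exact: (bsupp_integrable (bsuppD bug (bsuppN buc))).
  rewrite mulrC -(RintegralZl 16^-1 measurableT iu); apply: le_Rintegral => //.
  - have := bsupp_integrable (bsuppD bug (bsuppN buc)).
    by move=> /integrable_abse.
  - exact: (bsupp_integrable (bsuppMr (bmeas_cst _ 16^-1) bu)).
  move=> w _; have [->|uw] := eqVneq (u w) 0; first by rewrite mul0r !mulr0 subrr normr0.
  rewrite [X in `|X|](_ : _ = u w * (g w - c)); last by ring.
  rewrite normrM ger0_norm ?(window_ge0 Wu)// mulrC.
  by apply: ler_wpM2r; [exact: (window_ge0 Wu)|exact: gc].
rewrite (_ : mass / 8 = mass / 16 + mass / 16); last by field.
have [c1 c2] := cE.
apply: lerD.
  have := key _ 1 c1; rewrite mul1r => H.
  apply: le_trans (H _); last first.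
    move=> w /theta th; rewrite /= -[X in _ - X]cos0; apply: le_trans (cos_lipschitz _ _) _.
    by rewrite subr0.
  rewrite le_eqVlt; apply/orP; left; apply/eqP; congr `|_ - _|.
  by apply: eq_Rintegral => w _; rewrite mul0r subr0.
have := key _ 0 c2; rewrite mul0r => H.
apply: le_trans (H _); last first.
  move=> w /theta th; rewrite /= -[X in _ - X]sin0; apply: le_trans (sin_lipschitz _ _) _.
  by rewrite subr0.
rewrite le_eqVlt; apply/orP; left; apply/eqP; congr `|_ - _|.
by apply: eq_Rintegral => w _; rewrite mul0r addr0.
Qed.

End test_functions.
Lemma ler_pdiv2l (R : realType) (c a b : R) :
  0 <= c -> 0 < a -> a <= b -> c / b <= c / a.
Proof.
move=> c0 a0 ab; apply: ler_wpM2l => //.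
by rewrite lef_pV2// posrE// (lt_le_trans a0).
Qed.

(** * Lower bound for the pairing *)

Section lower_bound.
Context (R : realType) (d : nat).
Local Notation V := 'rV[R]_d.+1.
Local Notation leb := (lebesgue_rV R d.+1).
Local Notation normc := ComplexField.Normc.normc.
Variables (L M k : R) (u u1 u2 : V -> R).
Hypotheses (L1 : 1 <= L) (k0 : 0 < k).
Hypotheses (Wu : window L M k u) (Wu1 : window L M k u1) (Wu2 : window L M k u2).
Implicit Types (y s t x w : V) (n : nat) (b : bool) (alpha : V -> R).
Local Notation K := (dilation d L).

Let L0 : 0 < L. Proof. exact: lt_le_trans L1. Qed.
Let K1 : 1 <= K. Proof. exact: dilation_ge1. Qed.
Let K0 : 0 < K. Proof. exact: lt_le_trans K1. Qed.

(** Half of [k / K]: two points of a slab of this radius differ by less than [k] in each coordinate,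
    which keeps the windows at least 1/2, and the envelope [bump 0] is at least 1/2 on such a slab
    too. *)
Definition radius : R := k / (2 * K).
(** One volume factor for each of the variables x, s and t, and 1/16 for two bumps and two windows,
    each at least 1/2. The factor N of the Rudin-Shapiro identity has cancelled against the width
    1/N of the box for s. *)
Definition gain : R := mass u * ((2 * radius) ^+ d.+1) ^+ 3 / 16.

Lemma radius_gt0 : 0 < radius.
Proof. by rewrite divr_gt0// mulr_gt0. Qed.

Lemma gain_gt0 : 0 < gain.
Proof.
rewrite divr_gt0// mulr_gt0 ?(mass_gt0 L1 k0 Wu)// !exprn_gt0//.
by rewrite mulr_gt0// radius_gt0.
Qed.

(** The spatial factor of the kernel. Its sign, inherited from the windows and [alpha], is what
    allows the pairing to be bounded from below on a small box only. *)
Let mconv alpha s t : R := \int[leb]_x (alpha x * (u1 (s - x) * u2 (t - x))).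

Let bmeas_reflect (v : V -> R) s : window L M k v -> bmeas (fun x => v (s - x)).
Proof.
move=> Wv; have [mv [N vN]] := window_bmeas Wv; split; last by exists N.
apply: (measurableT_comp mv).
by apply: measurable_sub_rV; [exact: measurable_cst|exact: measurable_id].
Qed.

Let bsupp_mconv alpha s t : bsupp leb alpha ->
  bsupp leb (fun x => alpha x * (u1 (s - x) * u2 (t - x))).
Proof.
move=> ba; apply: bsuppMl => //.
exact: bmeasM (bmeas_reflect s Wu1) (bmeas_reflect t Wu2).
Qed.

Let mconv_ge0 alpha s t : (forall x, 0 <= alpha x) -> 0 <= mconv alpha s t.
Proof.
move=> a0; apply: Rintegral_ge0 => x _.
by rewrite !mulr_ge0// ?(window_ge0 Wu1) ?(window_ge0 Wu2).
Qed.

Let near_window (v : V -> R) y s x : window L M k v ->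
  slab y radius radius s -> slab y radius radius x -> 2^-1 <= v (s - x).
Proof.
move=> Wv sy xy; apply: (window_near Wv) => i; rewrite !mxE.
have := sy i; have := xy i; rewrite !if_same => xi si.
have -> : s ord0 i - x ord0 i = (s ord0 i - y ord0 i) - (x ord0 i - y ord0 i) by ring.
apply: le_lt_trans (ler_normB _ _) _.
apply: lt_le_trans (ltrD si xi) _.
have -> : radius + radius = k / K by rewrite /radius; field; rewrite gt_eqF.
by rewrite ler_pdivrMr// ler_peMr// ltW.
Qed.

Let mconv_ge alpha kap y s t : bsupp leb alpha -> 0 <= kap ->
  (forall x, 0 <= alpha x) -> (forall x, slab y radius radius x -> kap <= alpha x) ->
  slab y radius radius s -> slab y radius radius t ->
  kap / 4 * (2 * radius) ^+ d.+1 <= mconv alpha s t.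
Proof.
move=> ba kap0 a0 ak sy ty; have r0 := radius_gt0.
have := Rintegral_ge (E := slab y radius radius) (c := kap / 4) _
  (bsupp_integrable (bsupp_mconv s t ba)) (measurable_slab _ _ _)
  (lebesgue_slab_fin _ r0 r0) _ _.
have -> : fine (leb (slab y radius radius)) = (2 * radius) ^+ d.+1.
  by have := lebesgue_slab y r0 r0 => /= ->; rewrite /= exprS.
apply.
- by rewrite divr_ge0.
- by move=> x; rewrite !mulr_ge0// ?(window_ge0 Wu1) ?(window_ge0 Wu2).
- move=> x xy; apply: ler_pM; rewrite ?invr_ge0 ?ak//.
  rewrite (_ : 4^-1 = 2^-1 * 2^-1); last by field.
  by apply: ler_pM; rewrite ?invr_ge0//; [exact: near_window sy xy|exact: near_window ty xy].
Qed.

Let N2 n : Num.sqrt 2 ^+ n * Num.sqrt 2 ^+ n = 2 ^+ n :> R.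
Proof. by rewrite -exprMn -expr2 sqr_sqrtr. Qed.

(** [Re_conj_mul_ge] with an error [mass u / 8] in the transform and sqrt(N)/8 in the polynomial;
    the main terms are squared moduli at the same point [t - y], which the Rudin-Shapiro identity
    sums over [b]. *)
Let phases n y s t : bump L u n y s != 0 -> bump L u 0 y t != 0 ->
  mass u * 2 ^+ n <= \sum_(b : bool)
    complex.Re (conjc (rs (2 * L) n b (t ord0 ord0 - y ord0 ord0)) *
      (Cintegral leb (fun w => (u w)%:C * expi (2 * pi * dotV w (t - s))) *
       rs (2 * L) n b (t ord0 ord0 - s ord0 ord0))).
Proof.
move=> /(bump_supp L1 Wu) sy /(bump_supp L1 Wu) ty.
pose r : R := Num.sqrt 2; have r0 : 0 <= r by exact: sqrtr_ge0.
have rle : r <= 3 / 2.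
  by rewrite -(ler_pXn2r (n := 2)) ?nnegrE// ?sqr_sqrtr//; lra.
have N0 : 0 < 2 ^+ n :> R by rewrite exprn_gt0.
have N1 : 1 <= 2 ^+ n :> R by rewrite exprn_ege1// ler1n.
have LK : L / (K * 2 ^+ n) <= L / K.
  exact: ler_pdiv2l (ltW L0) K0 (ler_peMr (ltW K0) N1).
have m0 := mass_gt0 L1 k0 Wu.
have W8 := window_fourier L1 Wu (v := t - s).
have D8 b : normc (rs (2 * L) n b (t ord0 ord0 - s ord0 ord0) -
    rs (2 * L) n b (t ord0 ord0 - y ord0 ord0)) <= r ^+ n / 8.
  apply: le_trans (rs_lipschitz _ _ _ _ _) _; first by rewrite mulr_gt0.
  have -> : t ord0 ord0 - s ord0 ord0 - (t ord0 ord0 - y ord0 ord0) =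
    - (s ord0 ord0 - y ord0 ord0) by ring.
  rewrite normrN.
  have syo : `|s ord0 ord0 - y ord0 ord0| <= L / (K * 2 ^+ n) := ltW (sy ord0).
  have c0 : 0 <= 60 * (2 * L) * 2 ^+ n * r ^+ n by rewrite !mulr_ge0 ?exprn_ge0// ltW.
  apply: le_trans (ler_wpM2l c0 syo) _.
  (* The constant 960 = 8 * 120 of [dilation] is fitted to this quotient. *)
  have -> : 60 * (2 * L) * 2 ^+ n * r ^+ n * (L / (K * 2 ^+ n)) =
      r ^+ n / 8 * d.+1%:R^-1.
    have : d.+1%:R != 0 :> R by rewrite pnatr_eq0.
    have : L != 0 by rewrite gt_eqF.
    have : 2 ^+ n != 0 :> R by rewrite gt_eqF.
    by rewrite /dilation => ? ? ?; field; apply/and3P.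
  by rewrite ler_piMr ?divr_ge0 ?exprn_ge0// invf_le1// ler1n.
have H b := Re_conj_mul_ge (ltW m0) (normc_rs_le (2 * L) n b (t ord0 ord0 - y ord0 ord0))
  (normc_rs_le (2 * L) n b (t ord0 ord0 - s ord0 ord0)) (D8 b) (W8 _).
have vK i : `|(t - s) ord0 i| <= 2 * L / K.
  rewrite !mxE.
  have -> : t ord0 i - s ord0 i = (t ord0 i - y ord0 i) - (s ord0 i - y ord0 i) by ring.
  apply: le_trans (ler_normB _ _) _.
  rewrite (_ : 2 * L / K = L / K + L / K); last by ring.
  apply: lerD; apply: ltW; first by have := ty i; rewrite expr0 mulr1 if_same.
  by apply: lt_le_trans (sy i) _; case: ifP.
rewrite big_bool; apply: le_trans (lerD (H vK true) (H vK false)).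
have := normc_rs2 (2 * L) n (t ord0 ord0 - y ord0 ord0).
rewrite !(exprS _ n) -/r => P2.
have rr : r * r = 2 by rewrite -expr2 sqr_sqrtr.
have RN : r ^+ n * r ^+ n = 2 ^+ n := N2 n.
set p0 := normc _ in P2 *; set p1 := normc _ in P2 *.
have e1 : (r * r ^+ n) ^+ 2 = 2 * 2 ^+ n by rewrite expr2 mulrACA rr RN.
have e2 : r * r ^+ n * (r ^+ n / 8) = r * 2 ^+ n / 8.
  by rewrite mulrA -(mulrA r) RN.
rewrite e1 e2.
(* In units of [mass u * 2 ^+ n], the main term is 2 and the errors are 1/2 and [r / 4], at most
   3/8. *)
have : mass u * (p0 ^+ 2 + p1 ^+ 2) = mass u * (2 * 2 ^+ n) by rewrite P2.
have : mass u * (r * 2 ^+ n) <= mass u * (3 / 2 * 2 ^+ n).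
  by rewrite ler_pM2l// ler_pM2r.
have := mulr_gt0 m0 N0.
by lra.
Qed.

(** For a single [b] the integrand may have either sign. Only the sum over [b] is bounded below
    pointwise by a nonnegative function, so the two integrands are added before the domain is
    restricted. *)
Lemma locop_lower_bound n y alpha kap : bsupp leb alpha -> 0 <= kap ->
  (forall x, 0 <= alpha x) -> (forall x, slab y radius radius x -> kap <= alpha x) ->
  kap * gain <= \sum_(b : bool) complex.Re
    (locop (fun z => (alpha z.1)%:C * (rsymb L u n b z.2)%:C)
      (fun t => (u1 t)%:C) (fun t => (u2 t)%:C)
      (fun s => (bump L u n y s)%:C) (flat L u n b y)).
Proof.
move=> ba kap0 a0 ak.
have rc (v : V -> R) : bmeas v -> Cbmeas (fun t => (v t)%:C).
  by move=> bv; split=> //=; exact: bmeas_cst.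
have H b := locop_tensor (rc _ (window_bmeas Wu1)) (rc _ (window_bmeas Wu2))
  (Cbsupp_real (bump_bsupp L1 Wu n y)) (flat_bsupp L1 Wu n b y) (Cbsupp_real ba)
  (Cbsupp_real (rsymb_bsupp L1 Wu n b)).
pose G b (p : V * V) : R := bump L u n y p.1 * bump L u 0 y p.2 *
  mconv alpha p.1 p.2 *
  complex.Re (conjc (rs (2 * L) n b (p.2 ord0 ord0 - y ord0 ord0)) *
      (Cintegral leb (fun w => (u w)%:C * expi (2 * pi * dotV w (p.2 - p.1))) *
       rs (2 * L) n b (p.2 ord0 ord0 - p.1 ord0 ord0))).
have GE b : complex.Re (locop (fun z => (alpha z.1)%:C * (rsymb L u n b z.2)%:C)
      (fun t => (u1 t)%:C) (fun t => (u2 t)%:C)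
      (fun s => (bump L u n y s)%:C) (flat L u n b y)) = \int[(leb \x leb)%E]_p G b p
    /\ (leb \x leb)%E.-integrable setT (EFin \o G b).
  have [-> iG] := H b.
  have GE' p : complex.Re ((bump L u n y p.1)%:C * conjc (flat L u n b y p.2) *
    (Cintegral leb (fun x => (alpha x)%:C *
      (conjc ((u1 (p.1 - x))%:C) * (u2 (p.2 - x))%:C)) *
     Cintegral leb (fun w => (rsymb L u n b w)%:C * expi (2 * pi * dotV w (p.2 - p.1)))))
     = G b p.
    rewrite (rs_symbol_fourier _ _ _ _ (window_bsupp L0 Wu)).
    have -> : Cintegral leb (fun x => (alpha x)%:C *
        (conjc ((u1 (p.1 - x))%:C) * (u2 (p.2 - x))%:C)) = (mconv alpha p.1 p.2)%:C.
      rewrite -Cintegral_real; apply: eq_Cintegral => x.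
      by rewrite conjc_real !rmorphM.
    rewrite /G /flat !mxE.
    set W := Cintegral _ _; set P := rs _ _ _ _; set P' := rs _ _ _ _.
    have cM (z z' : R[i]) : conjc (z * z') = conjc z * conjc z' by exact: rmorphM.
    rewrite cM conjc_real.
    rewrite (_ : _ * _ = (bump L u n y p.1 * bump L u 0 y p.2 * mconv alpha p.1 p.2)%:C
      * (conjc P * (W * P'))); last by rewrite !rmorphM /=; ring.
    by rewrite ReM /= mul0r subr0.
  split; first by apply: eq_Rintegral => p _; exact: GE'.
  by apply: eq_integrable iG => // p _; congr EFin; exact: GE'.
have Gsum p : bump L u n y p.1 * bump L u 0 y p.2 * mconv alpha p.1 p.2 *
    (mass u * 2 ^+ n) <= G true p + G false p.
  have B0 : 0 <= bump L u n y p.1 * bump L u 0 y p.2 * mconv alpha p.1 p.2.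
    by rewrite !mulr_ge0 ?(bump_ge0 _ _ _ Wu)// ?mconv_ge0// (bump_ge0 Wu).
  rewrite -mulrDr; have [s0|s0] := eqVneq (bump L u n y p.1) 0.
    by rewrite s0 !mul0r.
  have [t0|t0] := eqVneq (bump L u 0 y p.2) 0.
    by rewrite t0 mulr0 !mul0r.
  by apply: ler_wpM2l => //; have := phases s0 t0; rewrite big_bool.
have r0 := radius_gt0; have m0 := mass_gt0 L1 k0 Wu.
have N0 : 0 < 2 ^+ n :> R by rewrite exprn_gt0.
have N1 : 1 <= 2 ^+ n :> R by rewrite exprn_ege1// ler1n.
rewrite (eq_bigr _ (fun b _ => (GE b).1)) big_bool.
have iG1 := (GE true).2; have iG0 := (GE false).2.
have GD := RintegralD measurableT iG1 iG0.
apply: le_trans (_ : _ <= \int[(leb \x leb)%E]_p (G true p + G false p)) _; last first.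
  by rewrite le_eqVlt; apply/orP; left; apply/eqP; exact: GD.
(* The first side shrinks with the spike; the resulting 1/N is compensated by the factor [2 ^+ n]
   from [phases]. *)
pose E1 := slab y (radius / 2 ^+ n) radius; pose E2 := slab y radius radius.
have rn0 : 0 < radius / 2 ^+ n by rewrite divr_gt0.
have EE : ((leb \x leb)%E (E1 `*` E2) =
    (2 * (radius / 2 ^+ n) * (2 * radius) ^+ d * (2 * radius) ^+ d.+1)%:E)%E.
  apply: etrans (product_measure1E _ _ _ _) _; [exact: measurable_slab|exact: measurable_slab|].
  have e1 := lebesgue_slab y rn0 r0; have e2 := lebesgue_slab y r0 r0.
  by rewrite EFinM; congr (_ * _)%E; [exact: e1|rewrite exprS; exact: e2].
have Efin : ((leb \x leb)%E (E1 `*` E2) < +oo)%E by rewrite EE ltry.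
pose c := 4^-1 * (kap / 4 * (2 * radius) ^+ d.+1) * (mass u * 2 ^+ n).
have c0 : 0 <= c.
  apply: mulr_ge0; last by apply: mulr_ge0; exact: ltW.
  apply: mulr_ge0; first by rewrite invr_ge0.
  apply: mulr_ge0; first exact: divr_ge0.
  by apply: exprn_ge0; rewrite mulr_ge0// ltW.
have rk : radius <= k / K.
  apply: ler_pdiv2l (ltW k0) K0 _.
  by rewrite mulr2n mulrDl mul1r lerDl ltW.
have sub1 s : E1 s -> slab y (k / (K * 2 ^+ n)) (k / K) s.
  apply: slab_sub => //; rewrite invfM mulrA; apply: ler_wpM2r rk.
  by rewrite invr_ge0 ltW.
have sub2 s : E1 s -> slab y radius radius s.
  by apply: slab_sub => //; rewrite ler_pdivrMr//; exact: ler_peMr (ltW r0) N1.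
have sub3 t : E2 t -> slab y (k / (K * 2 ^+ 0)) (k / K) t.
  by rewrite expr0 mulr1; apply: slab_sub.
have -> : kap * gain = c * fine ((leb \x leb)%E (E1 `*` E2)).
  rewrite EE /= /c /gain !exprS; field.
  by rewrite gt_eqF.
apply: Rintegral_ge => //.
- exact: (integrableD measurableT iG1 iG0).
- by apply: measurableX; exact: measurable_slab.
- move=> p; apply: le_trans (Gsum p).
  by rewrite !mulr_ge0 ?(bump_ge0 Wu)// ?mconv_ge0// ?ltW.
move=> p [E1p E2p]; apply: le_trans (Gsum p); rewrite /c.
apply: ler_wpM2r; first by rewrite mulr_ge0 ?ltW.
rewrite (_ : 4^-1 = 2^-1 * 2^-1); last by field.
apply: ler_pM.
- by rewrite !mulr_ge0 ?invr_ge0.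
- by rewrite !mulr_ge0 ?exprn_ge0// mulr_ge0// ltW.
- apply: ler_pM; rewrite ?invr_ge0//; first exact: (bump_near L1 Wu (sub1 _ E1p)).
  exact: (bump_near L1 Wu (sub3 _ E2p)).
- rewrite (_ : 2^-1 / 2 = 4^-1); last by field.
  exact: (mconv_ge ba kap0 a0 ak (sub2 _ E1p) E2p).
Qed.

End lower_bound.
(** * Upper bound for the pairing *)

Section locop_symmetry.
Context (R : realType) (d : nat).
Local Notation V := 'rV[R]_d.

(** For a real symbol the two integrands are complex conjugates, so their real parts agree
    pointwise. This plays the part of the adjoint operator. *)
Lemma Re_locop_swap (a : V * V -> R[i]) (phi1 phi2 f g : V -> R[i]) :
  (forall z, conjc (a z) = a z) ->
  complex.Re (locop a phi1 phi2 f g) = complex.Re (locop a phi2 phi1 g f).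
Proof.
move=> ra; apply: eq_Rintegral => z _.
rewrite -{1}(ra z); move: (stft phi1 f _ _) (stft phi2 g _ _) (ra z) => [p q] [s t].
case: (a z) => x y [] yy; rewrite !ReM !ImM /=.
have -> : y = 0 by lra.
ring.
Qed.

Lemma Cintegral0 dd (T : measurableType dd) (mu : {measure set T -> \bar R})
    (F : T -> R[i]) : (forall x, F x = 0) -> Cintegral mu F = 0.
Proof.
move=> F0; rewrite (_ : F = fun=> (0 : R)%:C); last exact/funext.
by rewrite Cintegral_real Rintegral_cst//= mul0r.
Qed.

Lemma stft_eq0 (phi f : V -> R[i]) (x w : V) :
  (forall t, f t != 0 -> phi (t - x) = 0) -> stft phi f x w = 0.
Proof.
move=> fphi; apply: Cintegral0 => t.
have [->|/fphi ->] := eqVneq (f t) 0; first by rewrite !mul0r.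
by rewrite conjc0 mulr0 mul0r.
Qed.

(** Over points [x] away from [f] the short-time Fourier transform vanishes, the window having small
    support. This locality lets a test function see a single piece of a symbol. *)
Lemma eq_locop (a a' : V * V -> R[i]) (phi1 phi2 f g : V -> R[i]) (E : set V) :
  (forall t x, f t != 0 -> ~ E x -> phi1 (t - x) = 0) ->
  (forall z, E z.1 -> a z = a' z) -> locop a phi1 phi2 f g = locop a' phi1 phi2 f g.
Proof.
move=> fE aE; apply: eq_Cintegral => z.
have [/aE -> //|nE] := pselect (E z.1).
rewrite (_ : stft phi1 f z.1 z.2 = 0) ?mulr0 ?mul0r//.
by apply: stft_eq0 => t ft; exact: fE ft nE.
Qed.

End locop_symmetry.

Section upper_bound.
Context (R : realType) (d : nat).
Local Notation V := 'rV[R]_d.+1.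
Local Notation leb := (lebesgue_rV R d.+1).
Local Notation normc := ComplexField.Normc.normc.
Variables (L M k : R) (u u1 u2 : V -> R).
Hypotheses (L1 : 1 <= L) (k0 : 0 < k).
Hypotheses (Wu : window L M k u) (Wu1 : window L M k u1) (Wu2 : window L M k u2).
Implicit Types (y s t x w : V) (n : nat) (b sw : bool) (alpha : V -> R).
Local Notation K := (dilation d L).
Local Notation phi1 := (fun t => (u1 t)%:C).
Local Notation phi2 := (fun t => (u2 t)%:C).

Let L0 : 0 < L. Proof. exact: lt_le_trans L1. Qed.
Let K1 : 1 <= K. Proof. exact: dilation_ge1. Qed.
Let K0 : 0 < K. Proof. exact: lt_le_trans K1. Qed.

Definition spike n y s : R[i] := (bump L u n y s)%:C.

(* The spike is the input when [sw] is false and the dual test function when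
   [sw] is true. *)
Definition test_in sw n b y : V -> R[i] :=
  if sw then flat L u n b y else spike n y.
Definition test_out sw n b y : V -> R[i] :=
  if sw then spike n y else flat L u n b y.

Lemma schwartz_Csmooth (f : V -> R[i]) :
  smooth (fun x => complex.Re (f x)) /\ csupp (fun x => complex.Re (f x)) ->
  smooth (fun x => complex.Im (f x)) /\ csupp (fun x => complex.Im (f x)) ->
  schwartz f.
Proof.
move=> [s1 c1] [s2 c2]; split; first exact: (conj s1 s2).
  exact: (csupp_rapid s1 c1).
exact: (csupp_rapid s2 c2).
Qed.

Lemma schwartz_spike n y : schwartz (spike n y).
Proof.
apply: schwartz_Csmooth; split=> /=.
- exact: (smooth_bump Wu n y).
- exact: (csupp_bump L1 Wu n y).
- exact: smooth_cst.
- by exists set0 => //; exact: compact0.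
Qed.

Lemma schwartz_flat n b y : schwartz (flat L u n b y).
Proof. by have [? ?] := smooth_csupp_flat L1 Wu n b y; exact: schwartz_Csmooth. Qed.

Lemma schwartz_test_in sw n b y : schwartz (test_in sw n b y).
Proof. by case: sw; [exact: schwartz_flat|exact: schwartz_spike]. Qed.

Lemma locop_test_lower_bound sw n y alpha kap : bsupp leb alpha -> 0 <= kap ->
  (forall x, 0 <= alpha x) ->
  (forall x, slab y (radius d L k) (radius d L k) x -> kap <= alpha x) ->
  kap * gain L k u <= \sum_(b : bool) complex.Re
    (locop (fun z => (alpha z.1)%:C * (rsymb L u n b z.2)%:C) phi1 phi2
      (test_in sw n b y) (test_out sw n b y)).
Proof.
move=> ba kap0 a0 ak; case: sw; last exact: (locop_lower_bound L1 k0 Wu Wu1 Wu2 n ba kap0 a0 ak).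
(* Exchanging the test functions exchanges the windows too. *)
apply: le_trans (locop_lower_bound L1 k0 Wu Wu2 Wu1 n ba kap0 a0 ak) _.
apply: ler_sum => b _; rewrite le_eqVlt; apply/orP; left; apply/eqP.
by apply: Re_locop_swap => z; rewrite -rmorphM conjc_real.
Qed.

Definition volume : R := (2 * (L / K)) ^+ d.+1.

Lemma volume_gt0 : 0 < volume.
Proof. by rewrite exprn_gt0// mulr_gt0// divr_gt0. Qed.

Let Cmeas_bsupp f : Cbsupp leb f -> Cmeas f.
Proof. by move=> [[[? _] _] [[? _] _]]. Qed.

Lemma spike_bounds n y : [/\ Cmeas (spike n y), forall s, normc (spike n y s) <= M &
  exists E, [/\ measurable E, (leb E <= (volume / 2 ^+ n)%:E)%E &
    forall s, ~ E s -> spike n y s = 0]].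
Proof.
have N0 : 0 < 2 ^+ n :> R by rewrite exprn_gt0.
split.
- exact/Cmeas_bsupp/Cbsupp_real/(bump_bsupp L1 Wu).
- by move=> s; rewrite normc_real ger0_norm ?(bump_ge0 Wu)// (bump_le Wu).
exists (slab y (L / (K * 2 ^+ n)) (L / K)); split; first exact: measurable_slab.
  have a0 : 0 < L / (K * 2 ^+ n) by rewrite divr_gt0// mulr_gt0.
  have b0 : 0 < L / K by rewrite divr_gt0.
  rewrite le_eqVlt; apply/orP; left; apply/eqP.
  apply: etrans (lebesgue_slab y a0 b0) _; congr EFin.
  by rewrite /volume exprS invfM; ring.
move=> s ns; rewrite /spike (_ : bump L u n y s = 0)//.
by apply/eqP; apply: contrapT => /negP /(bump_supp L1 Wu).
Qed.

Lemma flat_bounds n b y : [/\ Cmeas (flat L u n b y),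
  forall s, normc (flat L u n b y s) <= M * Num.sqrt 2 ^+ n.+1 &
  exists E, [/\ measurable E, (leb E <= volume%:E)%E &
    forall s, ~ E s -> flat L u n b y s = 0]].
Proof.
split; first exact/Cmeas_bsupp/(flat_bsupp L1 Wu).
  by move=> s; exact: (normc_flat_le Wu).
exists (slab y (L / K) (L / K)); split; first exact: measurable_slab.
  have b0 : 0 < L / K by rewrite divr_gt0.
  rewrite le_eqVlt; apply/orP; left; apply/eqP.
  apply: etrans (lebesgue_slab y b0 b0) _; congr EFin.
  by rewrite /volume exprS.
by move=> s; exact: (flat_supp L1 Wu).
Qed.

(** The norm of the spike is at most of order N to the power [- loss]: in L^p when it is the input,
    in the dual exponent when it is the output. *)
Definition loss sw (p : \bar R) : R := if sw then 1 - expo p else expo p.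

(** Sup bound of the spike, sup bound of the flat function without its factor sqrt N, and [volume]
    as the product of its powers of exponents [expo p] and [1 - expo p]. *)
Definition test_const : R := M * (M * Num.sqrt 2) * volume.

(** Hölder on the support of [G], applied to the function of L^p that represents the operator at
    [F]; the norm of the latter is controlled by the height and support of [F]. *)
Lemma pairing_bound (p : \bar R) (F G : V -> R[i]) (MF MG vF vG C : R)
    (a : V * V -> R[i]) : (1 <= p)%E -> schwartz G ->
  Cmeas F -> Cmeas G -> 0 <= MF -> 0 <= MG -> 0 <= vF -> 0 <= vG -> 0 <= C ->
  (forall s, normc (F s) <= MF) -> (forall s, normc (G s) <= MG) ->
  (exists E, [/\ measurable E, (leb E <= vF%:E)%E & forall s, ~ E s -> F s = 0]) ->
  (exists E, [/\ measurable E, (leb E <= vG%:E)%E & forall s, ~ E s -> G s = 0]) ->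
  locop_Lnorm_le p a phi1 phi2 F (C%:E * CLnorm leb p F)%E ->
  `|complex.Re (locop a phi1 phi2 F G)| <=
    C * (MF * MG * (vF `^ expo p * vG `^ (1 - expo p))).
Proof.
move=> p1 sG mF mG MF0 MG0 vF0 vG0 C0 FM GM [EF [mEF EFv FE]] [EG [mEG EGv GE]].
move=> [h [[h1 h2 hoo] hG hC]]; rewrite -hG// -lee_fin.
apply: le_trans (Re_inner_le p1 (conj h1 h2) mG mEG EGv vG0 MG0 GM GE) _.
have HF := CLnorm_le p1 mF mEF EFv vF0 MF0 FM FE.
have hC' : (CLnorm leb p h <= (C * (MF * vF `^ expo p))%:E)%E.
  by apply: le_trans hC _; rewrite [leRHS]EFinM; apply: lee_wpmul2l.
have -> : C * (MF * MG * (vF `^ expo p * vG `^ (1 - expo p))) =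
  MG * (C * (MF * vF `^ expo p) * vG `^ (1 - expo p)) by ring.
rewrite [leRHS]EFinM; apply: lee_wpmul2l => //.
by rewrite [leRHS]EFinM; apply: lee_wpmul2r => //; rewrite lee_fin powR_ge0.
Qed.

Lemma test_upper_bound sw (p : \bar R) n b y (a : V * V -> R[i]) (C : R) :
  (1 <= p)%E -> 0 <= C ->
  locop_Lnorm_le p a phi1 phi2 (test_in sw n b y)
    (C%:E * CLnorm leb p (test_in sw n b y))%E ->
  `|complex.Re (locop a phi1 phi2 (test_in sw n b y) (test_out sw n b y))| <=
    C * (test_const * (2 ^+ n) `^ (2^-1 - loss sw p)).
Proof.
move=> p1 C0 H.
have [sm sM sE] := spike_bounds n y; have [fm fM fE] := flat_bounds n b y.
have M0 := ltW (M_gt0 k0 Wu); have v0 := volume_gt0.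
have N0 : 0 < 2 ^+ n :> R by rewrite exprn_gt0.
have r0 : 0 <= Num.sqrt 2 :> R by exact: sqrtr_ge0.
have Mr0 : 0 <= M * Num.sqrt 2 ^+ n.+1 by rewrite mulr_ge0 ?exprn_ge0.
have vn0 : 0 <= volume / 2 ^+ n by rewrite divr_ge0// ltW.
have rn : Num.sqrt 2 ^+ n = (2 ^+ n) `^ 2^-1 :> R.
  rewrite powR12_sqrt ?ltW//; apply/eqP.
  rewrite -(@eqrXn2 _ 2) ?exprn_ge0 ?sqrtr_ge0// sqr_sqrtr ?ltW//.
  by rewrite -exprM mulnC exprM sqr_sqrtr.
have vs (e : R) : (volume / 2 ^+ n) `^ e = volume `^ e * (2 ^+ n) `^ (- e).
  by rewrite powRM ?invr_ge0 ?ltW// -(powR_inv1 (ltW N0)) -powRrM mulN1r.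
have e1 : volume `^ expo p * volume `^ (1 - expo p) = volume.
  rewrite -powRD; last by rewrite (gt_eqF v0) implybT.
  by rewrite addrC subrK powRr1// ltW.
have N2 (e : R) : (2 ^+ n) `^ (2^-1 - e) = (2 ^+ n) `^ 2^-1 * (2 ^+ n) `^ (- e).
  by rewrite powRD// (gt_eqF N0) implybT.
case: sw H => H.
  apply: le_trans (pairing_bound p1 (schwartz_spike n y) fm sm Mr0 M0 (ltW v0) vn0 C0
    fM sM fE sE H) _.
  rewrite vs /loss N2 -rn /test_const -[X in _ <= C * (_ * X * _)]e1 exprS.
  by rewrite le_eqVlt; apply/orP; left; apply/eqP; ring.
apply: le_trans (pairing_bound p1 (schwartz_flat n b y) sm fm M0 Mr0 vn0 (ltW v0) C0
  sM fM sE fE H) _.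
rewrite vs /loss N2 -rn /test_const -[X in _ <= C * (_ * X * _)]e1 exprS.
by rewrite le_eqVlt; apply/orP; left; apply/eqP; ring.
Qed.

(** The test function lives within [L] of [y] and the window has radius [L], at every scale. Hence
    slabs of half-width [2 * L] whose centres are [4 * L] apart separate the pieces of a symbol. *)
Lemma test_in_supp sw n b y t x : test_in sw n b y t != 0 ->
  ~ slab y (2 * L) (2 * L) x -> phi1 (t - x) = 0.
Proof.
move=> ft nx.
have N1 : 1 <= 2 ^+ n :> R by rewrite exprn_ege1// ler1n.
have tL : slab y L L t.
  have LK : L / K <= L by rewrite ler_pdivrMr//; exact: ler_peMr (ltW L0) K1.
  have LKn : L / (K * 2 ^+ n) <= L.
    by apply: le_trans (ler_pdiv2l (ltW L0) K0 (ler_peMr (ltW K0) N1)) LK.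
  case: sw ft => ft.
    apply: (slab_sub LK LK); apply: contrapT => nt.
    by move: ft; rewrite /test_in (flat_supp L1 Wu _ _ nt) eqxx.
  apply: (slab_sub LKn LK); apply: (bump_supp L1 Wu); apply: contraNN ft => /eqP b0.
  by rewrite /test_in /spike b0.
rewrite (_ : u1 (t - x) = 0)//; apply/eqP; apply: contrapT => /negP ux; apply: nx => i.
have := window_supp Wu1 ux i; have := tL i; rewrite !mxE !if_same => ti xi.
have -> : x ord0 i - y ord0 i = (t ord0 i - y ord0 i) - (t ord0 i - x ord0 i) by ring.
apply: le_lt_trans (ler_normB _ _) _.
by rewrite mulr2n mulrDl mul1r; exact: ltrD.
Qed.

End upper_bound.
(** * The symbols and the final comparison *)

Section piecewise.
Context dd (T : measurableType dd) (R : realType).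
Variable mu : {measure set T -> \bar R}.

Lemma measurable_piecewise (E : nat -> set T) (h : nat -> T -> R) (a : T -> R) :
  (forall m, measurable (E m)) -> (forall m, measurable_fun setT (h m)) ->
  (forall m z, E m z -> a z = h m z) -> (forall z, (forall m, ~ E m z) -> a z = 0) ->
  measurable_fun setT a.
Proof.
move=> mE mh aE a0 _ B mB; rewrite setTI.
rewrite (_ : a @^-1` B = \bigcup_m (E m `&` h m @^-1` B) `|`
    (if `[< B 0 >] then ~` \bigcup_m E m else set0)).
  apply: measurableU.
    apply: bigcup_measurable => m _; apply: measurableI => //.
    by rewrite -[X in measurable X]setTI; exact: mh.
  by case: ifP => // _; apply: measurableC; exact: bigcup_measurable.
apply/seteqP; split=> [z Bz|z].
  have [[m Em]|nE] := pselect (exists m, E m z).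
    by left; exists m => //; split=> //=; rewrite -aE.
  have nE' m : ~ E m z by move=> Em; apply: nE; exists m.
  right; rewrite asboolT; last by rewrite -(a0 z nE').
  by move=> [m _ /nE'].
move=> [[m _ [Em]]|]; first by rewrite /= (aE m).
case: ifPn => // /asboolP B0 nE; rewrite /= a0// => m Em.
by apply: nE; exists m.
Qed.

(** For finite [q] the power of |a| is at most the series of the powers of [A m] times the
    indicators of [E m]; integrated term by term, it is dominated by a geometric series of sum [B].
    For [+oo] the heights are at most [B]. *)
Lemma Lnorm_piecewise_lty (q : \bar R) (E : nat -> set T) (a : T -> R)
    (A v : nat -> R) (B : R) : (1 <= q)%E -> measurable_fun setT a ->
  (forall m, measurable (E m)) -> (forall m, (mu (E m) <= (v m)%:E)%E) ->
  (forall m z, E m z -> `|a z| <= A m) -> (forall z, (forall m, ~ E m z) -> a z = 0) ->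
  0 <= B -> (forall m, 0 <= A m <= B) ->
  (forall r, q = r%:E -> forall m, A m `^ r * v m <= B / (2 ^ m.+1)%:R) ->
  (Lnorm mu q (EFin \o a) < +oo)%E.
Proof.
move=> q1 ma mE Ev aA a0 B0 AB Ar.
case: q q1 Ar => [r r1 Ar|_ _|//]; last first.
  rewrite unlock /Lnorm; case: ifPn => // _.
  apply: (@le_lt_trans _ _ B%:E); last exact: ltry.
  apply/ess_supP; apply: nearW => z /=; rewrite lee_fin.
  have [[m Em]|nE] := pselect (exists m, E m z).
    by apply: le_trans (aA m z Em) _; have /andP[] := AB m.
  by rewrite a0 ?normr0// => m Em; apply: nE; exists m.
have r0 : 0 < r by move: r1; rewrite lee_fin; exact: lt_le_trans.
rewrite unlock /Lnorm; apply: poweR_lty.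
pose g m z : \bar R := ((A m `^ r)%:E * (\1_(E m) z)%:E)%E.
have g0 m z : (0 <= g m z)%E by rewrite mule_ge0// lee_fin ?powR_ge0.
have mg m : measurable_fun setT (g m).
  by apply/measurable_EFinP; apply: measurable_funM => //; exact: measurable_indic.
apply: (@le_lt_trans _ _ (\int[mu]_z \sum_(m <oo) g m z)%E).
  apply: ge0_le_integral => //.
  - by move=> z _; exact: poweR_ge0.
  - apply: (measurableT_comp (measurable_poweR r)).
    by apply: measurableT_comp => //; exact/measurable_EFinP.
  - by apply: ge0_emeasurable_sum => // m _; exact: mg.
  move=> z _ /=; have [[m Em]|nE] := pselect (exists m, E m z); last first.
    rewrite a0 => [|m Em]; last by apply: nE; exists m.
    by rewrite normr0 powR0 ?gt_eqF//; exact: nneseries_ge0.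
  apply: (@le_trans _ _ (g m z)).
    rewrite /g indicE mem_set//= mule1 lee_fin.
    have /andP[Am0 _] := AB m.
    by apply: ge0_ler_powR; rewrite ?nnegrE ?(ltW r0)//; exact: aA Em.
  apply: le_trans (nneseries_lim_ge m.+1 _) => //.
  by rewrite big_mkord big_ord_recr/= leeDr// sume_ge0.
rewrite integral_nneseries//.
apply: (@le_lt_trans _ _ B%:E); last exact: ltry.
apply: le_trans (epsilon_trick0 xpredT B0).
apply: lee_nneseries => [m _ _|m _]; first exact: integral_ge0.
apply: (@le_trans _ _ ((A m `^ r)%:E * mu (E m))%E).
  rewrite /g ge0_integralZl ?lee_fin ?powR_ge0//.
  - by rewrite integral_indic// setIT.
  - by apply/measurable_EFinP; exact: measurable_indic.
apply: (@le_trans _ _ ((A m `^ r)%:E * (v m)%:E)%E).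
  by apply: lee_wpmul2l; rewrite ?lee_fin ?powR_ge0.
by rewrite -EFinM lee_fin; exact: Ar.
Qed.

End piecewise.
(* [2 ^+ m] is what summability of the pieces of the gliding symbol costs; it is
   absorbed by taking [l] large. *)
Lemma exponent_ge0 (R : realType) (c x : R) : 0 < c ->
  (forall l : nat, exists C, forall m : nat,
    c <= C * (2 ^+ m * (2 ^+ (l * m)) `^ x)) -> 0 <= x.
Proof.
move=> c0 cC; rewrite leNgt; apply/negP => x0.
(* With [l] times [x] at most -2, the power of the scale is at most 4^-m, which beats the factor
   2^m. *)
pose l := (Num.truncn (2 / - x)).+1.
have lx : l%:R * x <= - 2.
  have : 2 / - x < l%:R by rewrite truncnS_gt.
  by rewrite ltr_pdivrMr ?oppr_gt0// mulrN => /ltW; rewrite lerNr.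
have two m : (2 ^+ (l * m) : R) `^ x <= (4^-1) ^+ m.
  rewrite -powR_mulrn// -powRrM natrM mulrAC powRrM powR_mulrn ?powR_ge0//.
  apply: lerXn2r; rewrite ?nnegrE ?powR_ge0 ?invr_ge0//.
  apply: le_trans (_ : 2 `^ (- 2) <= _).
    by apply: ler_powR => //; rewrite ler1n.
  by rewrite powRN powR_mulrn// -exprVn expr2 -invfM -natrM.
have {cC} [C cC] := cC l.
have C0 : 0 <= C.
  have := cC 0%N; rewrite muln0 !expr0 powR1 !mulr1; exact/le_trans/ltW.
have half m : c <= C * 2^-1 ^+ m.
  apply: le_trans (cC m) _; apply: ler_wpM2l => //.
  have -> : 2^-1 ^+ m = 2 ^+ m * 4^-1 ^+ m :> R.
    by rewrite -exprMn; congr (_ ^+ m); field.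
  by apply: ler_wpM2l; rewrite ?exprn_ge0.
have Cm m : m%:R <= C / c.
  rewrite ler_pdivlMr// ; have := half m.
  rewrite exprVn ler_pdivlMr ?exprn_gt0//; apply: le_trans.
  rewrite mulrC; apply: ler_wpM2l; first exact: ltW.
  by rewrite -natrX ler_nat; exact: ltnW (ltn_expl _ _).
have := Cm (Num.truncn (C / c)).+1; rewrite leNgt truncnS_gt//.
Qed.

Section product_space.
Context (R : realType) (V W : normedModType R).

Lemma smooth_fst (u : V -> R) : smooth u -> smooth (fun z : V * W => u z.1).
Proof.
apply: (@smooth_comp_affine _ (V * W)%type V fst fst u) => //.
by move=> z; exact: cvg_fst.
Qed.

Lemma smooth_snd (u : W -> R) : smooth u -> smooth (fun z : V * W => u z.2).
Proof.
apply: (@smooth_comp_affine _ (V * W)%type W snd snd u) => //.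
by move=> z; exact: cvg_snd.
Qed.

Lemma csuppX (u : V -> R) (v : W -> R) : csupp u -> csupp v ->
  csupp (fun z : V * W => u z.1 * v z.2).
Proof.
move=> [K cK uK] [L cL vL]; exists (K `*` L); first exact: compact_setX.
move=> [x y] /= nKL; have [Kx|/uK ->] := pselect (K x); last by rewrite mul0r.
by have [Ly|/vL ->] := pselect (L y); [case: nKL|rewrite mulr0].
Qed.

End product_space.

Lemma schwartz_real (R : realType) (V : normedModType R) (u : V -> R) :
  smooth u -> csupp u -> schwartz (fun x => (u x)%:C).
Proof.
move=> su cu; split; first exact: (conj su (@smooth_cst R V 0)).
- exact: csupp_rapid.
- by apply: csupp_rapid; [exact: smooth_cst|exists set0 => //; exact: compact0].
Qed.
Section symbols.
Context (R : realType) (d : nat).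
Local Notation V := 'rV[R]_d.+1.
Local Notation leb := (lebesgue_rV R d.+1).
Local Notation normc := ComplexField.Normc.normc.
Variables (L M k : R) (u : V -> R).
Hypotheses (L1 : 1 <= L) (k0 : 0 < k).
Hypothesis (Wu : window L M k u).
Local Notation leb2 := (leb \x leb)%E.

Let L0 : 0 < L. Proof. exact: lt_le_trans L1. Qed.
Let M0 : 0 <= M. Proof. exact: ltW (M_gt0 k0 Wu). Qed.

(** The frequency slab is centred at the midpoint of the strip from -L to 2LN - L that the
    translates fill. *)
Definition cell n (y : V) : set (V * V) :=
  slab y (2 * L) (2 * L) `*` slab ((L * 2 ^+ n - L) *: e0 R d) (L * 2 ^+ n) L.

Definition cell_volume : R := (2 * (2 * L)) ^+ d.+1 * (2 * L) ^+ d.+1.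

Lemma measurable_cell n y : measurable (cell n y).
Proof. by apply: measurableX; exact: measurable_slab. Qed.

Lemma cell_volume_ge0 : 0 <= cell_volume.
Proof. by rewrite mulr_ge0// exprn_ge0// mulr_ge0// ltW// mulr_gt0. Qed.

Lemma product_measure_cell n y :
  (leb2 (cell n y) <= (cell_volume * 2 ^+ n)%:E)%E.
Proof.
have N0 : 0 < L * 2 ^+ n by rewrite mulr_gt0// exprn_gt0.
have L2 : 0 < 2 * L by rewrite mulr_gt0.
rewrite le_eqVlt; apply/orP; left; apply/eqP.
apply: etrans (product_measure1E _ _ (measurable_slab _ _ _) (measurable_slab _ _ _)) _.
apply: etrans (congr2 mule (lebesgue_slab _ L2 L2) (lebesgue_slab _ N0 L0)) _.
by rewrite -EFinM; congr EFin; rewrite /cell_volume !exprS; ring.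
Qed.

Lemma rsymb_le n b w : `|rsymb L u n b w| <= M.
Proof.
apply: (rs_symbol_le n b L0 (window_supp Wu)) => {}w.
by rewrite ger0_norm ?(window_ge0 Wu)// (window_le Wu).
Qed.

Lemma rsymb_supp n b w : rsymb L u n b w != 0 ->
  slab ((L * 2 ^+ n - L) *: e0 R d) (L * 2 ^+ n) L w.
Proof.
move=> /(rs_symbol_supp L0 (window_supp Wu))[w0 wi] i.
rewrite [X in _ - X]mxE e0E; case: (eqVneq i ord0) => [->|/wi]; last by rewrite mulr0 subr0.
move: w0; rewrite mulr1 ltr_norml -mulrA => /andP[w1 w2].
by apply/andP; split; lra.
Qed.

(** The bump is reused as spatial factor: it keeps the symbol in the Schwartz class and is at least
    1/2 near 0, as the lower bound requires. *)
Definition compact_symbol n b (z : V * V) : R := u z.1 * rsymb L u n b z.2.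

Lemma schwartz_compact_symbol n b : schwartz (fun z => (compact_symbol n b z)%:C).
Proof.
have su := window_smooth Wu; have cu := window_csupp Wu.
have sr : smooth (rsymb L u n b) := @smooth_rs_symbol R d u (2 * L) n b su.
have cr : csupp (rsymb L u n b) := @csupp_rs_symbol R d u (2 * L) n b cu.
apply: schwartz_real; last exact: (csuppX cu cr).
exact: (smoothM (@smooth_fst R V V u su) (@smooth_snd R V V _ sr)).
Qed.

Let measurable_symbol (alpha beta : V -> R) : measurable_fun setT alpha ->
  measurable_fun setT beta -> measurable_fun setT (fun z : V * V => alpha z.1 * beta z.2).
Proof.
move=> ma mb; apply: measurable_funM.
  exact: (measurableT_comp ma measurable_fst).
exact: (measurableT_comp mb measurable_snd).
Qed.

Let measurable_rsymb n b : measurable_fun setT (rsymb L u n b).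
Proof. by have [[]] := rsymb_bsupp L1 Wu n b. Qed.

Lemma slab_window x : u x != 0 -> slab 0 (2 * L) (2 * L) x.
Proof.
move=> /(window_supp Wu) uL i; rewrite mxE subr0 if_same.
by apply: lt_le_trans (uL i) _; apply: ler_peMl; [exact: ltW|rewrite ler1n].
Qed.

Lemma CLnorm_compact_symbol q n b : (1 <= q)%E ->
  (CLnorm leb2 q (fun z => (compact_symbol n b z)%:C) <=
   (M * M * (cell_volume * 2 ^+ n) `^ expo q)%:E)%E.
Proof.
move=> q1; apply: (@CLnorm_le _ _ _ leb2 q _ (cell n 0)) => //.
- split; last exact: measurable_cst.
  by apply: measurable_symbol => //; have [] := window_bmeas Wu.
- exact: measurable_cell.
- exact: product_measure_cell.
- by rewrite mulr_ge0 ?cell_volume_ge0// exprn_ge0.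
- exact: mulr_ge0.
- move=> z; rewrite normc_real normrM; apply: ler_pM => //; last exact: rsymb_le.
  by rewrite ger0_norm ?(window_ge0 Wu)// (window_le Wu).
- move=> z nz; apply/eqP; apply: contrapT => /negP nz0; apply: nz.
  move: nz0; rewrite -(rmorph0 (real_complex R)) (inj_eq (@complexI R)).
  rewrite mulf_eq0 negb_or => /andP[ux rw].
  by split; [exact: slab_window|exact: (rsymb_supp rw)].
Qed.

End symbols.
Lemma locop_Lnorm_leW (R : realType) (d : nat) p a
    (phi1 phi2 f : 'rV[R]_d -> R[i]) (K K' : \bar R) : (K <= K')%E ->
  locop_Lnorm_le p a phi1 phi2 f K -> locop_Lnorm_le p a phi1 phi2 f K'.
Proof. by move=> KK [h [mh hg hK]]; exists h; split=> //; exact: le_trans KK. Qed.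

(** * Conditions on the exponents from each kind of boundedness *)

Section necessary_conditions.
Context (R : realType) (d : nat).
Local Notation V := 'rV[R]_d.+1.
Local Notation leb := (lebesgue_rV R d.+1).
Local Notation normc := ComplexField.Normc.normc.
Variables (L M k : R) (u u1 u2 : V -> R) (p q : \bar R) (sw : bool).
Hypotheses (L1 : 1 <= L) (k0 : 0 < k).
Hypotheses (Wu : window L M k u) (Wu1 : window L M k u1) (Wu2 : window L M k u2).
Hypotheses (p1 : (1 <= p)%E) (q1 : (1 <= q)%E).
Local Notation phi1 := (fun t => (u1 t)%:C).
Local Notation phi2 := (fun t => (u2 t)%:C).
Local Notation leb2 := (leb \x leb)%E.
Local Notation rad := (radius d L k).
Local Notation input n b y := (test_in L u sw n b y).
Local Notation output n b y := (test_out L u sw n b y).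

Let L0 : 0 < L. Proof. exact: lt_le_trans L1. Qed.
Let M0 : 0 <= M. Proof. exact: ltW (M_gt0 k0 Wu). Qed.
Let tc0 : 0 <= test_const d L M.
Proof.
by rewrite /test_const mulr_ge0 ?(ltW (volume_gt0 _ L1))// mulr_ge0// mulr_ge0// sqrtr_ge0.
Qed.
Let gain0 : 0 < gain L k u. Proof. exact: (gain_gt0 L1 k0 Wu). Qed.

Let powR2 (n : nat) (x y : R) : (2 ^+ n) `^ x * (2 ^+ n) `^ y = (2 ^+ n) `^ (x + y).
Proof.
have N0 : 0 < 2 ^+ n :> R by rewrite exprn_gt0.
by rewrite powRD// (gt_eqF N0) implybT.
Qed.

Let rad_le : rad <= k.
Proof.
have K1 := dilation_ge1 d L1.
have K0 : 0 < dilation d L by exact: lt_le_trans K1.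
have K2 : 0 < 2 * dilation d L by exact: mulr_gt0.
rewrite /radius ler_pdivrMr//; apply: ler_peMr; first exact: ltW.
by apply: le_trans K1 _; apply: ler_peMl; [exact: ltW|rewrite ler1n].
Qed.

(** At the point with all coordinates [L] the bump vanishes, whereas for [L < k] it would be at
    least 1/2 there. *)
Let k_le : k <= L.
Proof.
rewrite leNgt; apply/negP => Lk; have aL : `|L| = L by rewrite gtr0_norm.
have uL : u (const_mx L) != 0.
  rewrite gt_eqF//; apply: lt_le_trans (window_near Wu _); first by rewrite invr_gt0.
  by move=> i; rewrite mxE aL.
by have := window_supp Wu uL ord0; rewrite mxE aL ltxx.
Qed.

(** The constant is uniform, so one symbol at the origin per scale is enough; its norm brings the
    factor N^(1/q). *)
Lemma schwartz_bound_exponent (C : R) : 0 < C ->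
  (forall (f : V -> R[i]) (a : V * V -> R[i]), schwartz f -> schwartz a ->
    locop_Lnorm_le p a phi1 phi2 f (C%:E * CLnorm leb2 q a * CLnorm leb p f)%E) ->
  0 <= expo q + (2^-1 - loss sw p).
Proof.
move=> C0 bounded; apply: (@exponent_ge0 _ (2^-1 * gain L k u)) => [|l].
  by rewrite mulr_gt0// invr_gt0.
pose C1 := C * (M * M * cell_volume d L `^ expo q) * test_const d L M.
have C10 : 0 <= C1.
  by rewrite mulr_ge0// mulr_ge0 ?(ltW C0)// mulr_ge0 ?powR_ge0// mulr_ge0.
exists (2 * C1) => m; set n := (l * m)%N.
have sum_le : 2^-1 * gain L k u <= \sum_(b : bool)
    (C1 * (2 ^+ n) `^ (expo q + (2^-1 - loss sw p))).
  apply: le_trans (locop_test_lower_bound L1 k0 Wu Wu1 Wu2 sw n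
    (window_bsupp L0 Wu) _ (window_ge0 Wu) (y := 0) (kap := 2^-1) _) _.
  - by rewrite invr_ge0.
  - move=> x xk; apply: (window_near Wu) => i; have := xk i.
    by rewrite mxE subr0 if_same => /lt_le_trans; apply.
  apply: ler_sum => b _.
  have -> : (fun z : V * V => (u z.1)%:C * (rsymb L u n b z.2)%:C) =
      (fun z => (compact_symbol L u n b z)%:C).
    by apply/funext => z; rewrite -rmorphM.
  apply: le_trans (ler_norm _) _.
  have CK0 : 0 <= C * (M * M * (cell_volume d L * 2 ^+ n) `^ expo q).
    by rewrite mulr_ge0 ?(ltW C0)// mulr_ge0 ?powR_ge0// mulr_ge0.
  apply: le_trans (test_upper_bound L1 k0 Wu p1 CK0 _) _.
    apply: (@locop_Lnorm_leW _ _ _ _ _ _ _ (C%:E *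
      CLnorm leb2 q (fun z => (compact_symbol L u n b z)%:C) *
      CLnorm leb p (input n b 0))%E); last first.
      exact: (bounded _ _ (schwartz_test_in L1 Wu sw n b 0)
        (schwartz_compact_symbol Wu n b)).
    apply: lee_wpmul2r; first exact: Lnorm_ge0.
    rewrite EFinM; apply: lee_wpmul2l; first by rewrite lee_fin ltW.
    exact: (CLnorm_compact_symbol L1 k0 Wu n b q1).
  rewrite powRM ?cell_volume_ge0 ?exprn_ge0// -powR2 /C1.
  by rewrite le_eqVlt; apply/orP; left; apply/eqP; ring.
apply: le_trans sum_le _; rewrite big_bool /=.
set X := _ `^ _; have X0 : 0 <= X by exact: powR_ge0.
(* Uniformity leaves the factor 2^m of [exponent_ge0] to spare; it is bounded below by 1. *)
have E1 : 1 <= 2 ^+ m :> R by rewrite exprn_ege1// ler1n.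
have := ler_wpM2l (mulr_ge0 C10 X0) E1.
lra.
Qed.

(* A single symbol carries the counterexamples at all scales [level m], placed
   over disjoint slabs: the test functions at [center m] only see its [m]-th
   piece. *)
Let center (m : nat) : V := (4 * L * m%:R) *: e0 R d.
(* The only slab that can contain [x]. *)
Let index (x : V) : nat := Num.truncn ((x ord0 ord0 + 2 * L) / (4 * L)).

Let index_center m x : slab (center m) (2 * L) (2 * L) x -> index x = m.
Proof.
move=> /(_ ord0); rewrite [X in _ - X]mxE e0E eqxx mulr1 ltr_norml => /andP[x1 x2].
have L4 : 0 < 4 * L by rewrite mulr_gt0.
apply: truncn_def; rewrite ler_pdivlMr// ltr_pdivrMr// -natr1.
by apply/andP; split; [apply: ltW|]; lra.
Qed.

Section gliding_symbol.
Variables (l : nat) (b : nat -> bool).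

Definition level (m : nat) : nat := (l * m)%N.
(** The second factor normalizes the piece in L^q, so that its norm is at most of order 2^-m; for
    [q = +oo] it is 1. *)
Definition height (m : nat) : R := 2 ^- m * (2 ^+ level m) `^ (- expo q).

Definition plateau m (x : V) : R :=
  height m * \1_(slab (center m) (2 * L) (2 * L)) x.

Definition piece m (z : V * V) : R :=
  plateau m z.1 * rsymb L u (level m) (b m) z.2.

(** At most one of the disjoint slabs contains [z.1], so selecting a piece by [index] stands for the
    infinite sum of the pieces. *)
Definition gliding_symbol (z : V * V) : R := piece (index z.1) z.

Lemma height_ge0 m : 0 <= height m.
Proof. by rewrite mulr_ge0 ?powR_ge0// invr_ge0 exprn_ge0. Qed.

Lemma height_le1 m : height m <= 1.
Proof.
have e2 n : 1 <= 2 ^+ n :> R by rewrite exprn_ege1// ler1n.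
rewrite -[leRHS]mulr1; apply: ler_pM; rewrite ?powR_ge0 ?invr_ge0 ?exprn_ge0//.
  by rewrite invf_le1// exprn_gt0.
rewrite -[leRHS](powRr0 (2 ^+ level m)); apply: ler_powR => //.
by rewrite oppr_le0 expo_ge0.
Qed.

Lemma plateau_bsupp m : bsupp leb (plateau m).
Proof.
apply: bsuppMr; first exact: bmeas_cst.
split; first split.
- exact: measurable_indic (measurable_slab _ _ _).
- exists 1 => x; rewrite ger0_norm ?indicE ?ler0n//.
  by case: (_ \in _).
exists (slab (center m) (2 * L) (2 * L)); split; first exact: measurable_slab.
  by apply: lebesgue_slab_fin; rewrite mulr_gt0.
by move=> x nx; rewrite indicE memNset.
Qed.

Lemma plateau_ge0 m x : 0 <= plateau m x.
Proof. by rewrite mulr_ge0 ?height_ge0// indicE. Qed.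

Lemma plateau_near m x : slab (center m) rad rad x -> height m <= plateau m x.
Proof.
have r2 : rad <= 2 * L.
  apply: le_trans (le_trans rad_le k_le) _.
  by apply: ler_peMl; [exact: ltW|rewrite ler1n].
by move=> /(slab_sub r2 r2) xc; rewrite /plateau indicE mem_set// mulr1.
Qed.

Lemma measurable_piece m : measurable_fun setT (piece m).
Proof.
apply: measurable_funM.
  by apply: (measurableT_comp _ measurable_fst); have [[]] := plateau_bsupp m.
apply: (measurableT_comp _ measurable_snd).
by have [[]] := rsymb_bsupp L1 Wu (level m) (b m).
Qed.

Lemma gliding_symbolE m z : slab (center m) (2 * L) (2 * L) z.1 ->
  gliding_symbol z = piece m z.
Proof. by rewrite /gliding_symbol => /index_center ->. Qed.

Lemma piece_off m z : ~ cell L (level m) (center m) z -> piece m z = 0.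
Proof.
move=> nz; apply/eqP; rewrite mulf_eq0; apply: contrapT => /negP.
rewrite negb_or => /andP[p0 r0]; apply: nz; split; last exact: (rsymb_supp L1 Wu r0).
apply: contrapT => ns; move: p0.
by rewrite /plateau indicE memNset// mulr0 eqxx.
Qed.

(** For finite [q = r], the power of [height m] cancels the factor N in the volume of the cell and
    leaves 2^(-mr), at most 2^-m because r >= 1: the pieces are summable whatever the signs and
    [l]. *)
Lemma CLfun_gliding_symbol : CLfun leb2 q (fun z => (gliding_symbol z)%:C).
Proof.
have mE m := measurable_cell L (level m) (center m).
have aE m z : cell L (level m) (center m) z -> gliding_symbol z = piece m z.
  by move=> [zc _]; exact: gliding_symbolE.
have a0 z : (forall m, ~ cell L (level m) (center m) z) -> gliding_symbol z = 0.
  by move=> nz; exact: piece_off.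
have ma := measurable_piecewise mE measurable_piece aE a0.
split; [exact: ma|exact: (@measurable_cst _ _ _ _ setT (0 : R))|].
rewrite /CLnorm (_ : (fun z => _) = EFin \o (fun z => `|gliding_symbol z|)); last first.
  by apply/funext => z; congr EFin; exact: normc_real.
pose v m := cell_volume d L * 2 ^+ level m.
(* [M] bounds the heights, the other summand is the constant of the geometric series for finite
   [q]. *)
pose B := M + 2 * cell_volume d L * M `^ fine q.
have cv0 := cell_volume_ge0 d L1.
have B2 : 0 <= 2 * cell_volume d L * M `^ fine q.
  by rewrite mulr_ge0 ?powR_ge0// mulr_ge0.
apply: (@Lnorm_piecewise_lty _ _ _ leb2 q (fun m => cell L (level m) (center m)) _
    (fun m => height m * M) v B) => //.
- exact: measurableT_comp.
- by move=> m; exact: product_measure_cell.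
- move=> m z Ez; rewrite normr_id (aE m z Ez) normrM; apply: ler_pM => //.
    rewrite ger0_norm ?plateau_ge0// /plateau indicE.
    by rewrite -[leRHS]mulr1; apply: ler_wpM2l; [exact: height_ge0|case: (_ \in _)].
  exact: (rsymb_le L1 Wu).
- by move=> z /a0 ->; rewrite normr0.
- by rewrite addr_ge0.
- move=> m; rewrite mulr_ge0 ?height_ge0//=; apply: le_trans (_ : M <= B).
    by rewrite -[leRHS]mul1r; apply: ler_wpM2r => //; exact: height_le1.
  by rewrite lerDl.
move=> r qr m.
have r1 : 1 <= r by move: q1; rewrite qr lee_fin.
have r0 : 0 < r by exact: lt_le_trans r1.
have er : expo q = r^-1 by rewrite /expo qr inver gt_eqF.
have N0 : 0 < 2 ^+ level m :> R by rewrite exprn_gt0.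
have hr : (height m * M) `^ r = (2 ^- m) `^ r * (2 ^+ level m)^-1 * M `^ r.
  rewrite powRM ?height_ge0// powRM ?powR_ge0 ?invr_ge0 ?exprn_ge0//.
  by rewrite -powRrM er mulNr mulVf ?gt_eqF// powR_inv1// ltW.
have pw : (2 ^- m) `^ r <= 2 ^- m :> R.
  apply: ge1r_powR => //; rewrite invr_gt0 exprn_gt0//=.
  by rewrite invf_le1 ?exprn_gt0// exprn_ege1// ler1n.
rewrite hr /v.
have -> : (2 ^- m) `^ r * (2 ^+ level m)^-1 * M `^ r * (cell_volume d L * 2 ^+ level m) =
    (2 ^- m) `^ r * (cell_volume d L * M `^ r).
  by field; rewrite gt_eqF.
apply: le_trans (ler_wpM2r _ pw) _; first by rewrite mulr_ge0 ?powR_ge0.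
have -> : 2 ^- m * (cell_volume d L * M `^ r) =
    2 * cell_volume d L * M `^ r / (2 ^ m.+1)%:R.
  by rewrite natrX exprS; field; rewrite expf_neq0.
by apply: ler_wpM2r; rewrite ?invr_ge0// /B qr lerDr.
Qed.

End gliding_symbol.

Let CLfun_test_in n b y : CLfun leb p (input n b y).
Proof.
have [sm sM [E [mE Ev sE]]] := spike_bounds L1 Wu n y.
have [fm fM [F [mF Fv fF]]] := flat_bounds L1 Wu n b y.
have v0 := volume_gt0 d L1.
have fin (f : V -> R[i]) (G : set V) (A v : R) : Cmeas f -> 0 <= v -> 0 <= A ->
    (forall s, normc (f s) <= A) -> measurable G -> (leb G <= v%:E)%E ->
    (forall s, ~ G s -> f s = 0) -> CLfun leb p f.
  move=> mf v0' A0 fA mG Gv fG; have [m1 m2] := mf; split=> //.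
  by apply: le_lt_trans (CLnorm_le p1 mf mG Gv v0' A0 fA fG) _; rewrite ltry.
rewrite /test_in; case: sw.
  apply: (fin _ F _ _ fm (ltW v0) _ fM mF Fv fF).
  by rewrite mulr_ge0// exprn_ge0// sqrtr_ge0.
apply: (fin _ E _ _ sm _ M0 sM mE Ev sE).
by rewrite divr_ge0 ?(ltW v0)// exprn_ge0.
Qed.

(** The constant depends on the symbol, so the symbol must be fixed first. At each scale one of the
    two signs carries at least half of the lower bound, and this choice involves the pieces alone.
    The one constant of the resulting symbol then serves all scales. *)
Lemma bounded_exponent :
  (forall a, CLfun leb2 q a -> locop_bounded p a phi1 phi2) ->
  0 <= expo q + (2^-1 - loss sw p).
Proof.
move=> bounded; apply: (@exponent_ge0 _ (2^-1 * gain L k u)) => [|l].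
  by rewrite mulr_gt0// invr_gt0.
pose part b m (z : V * V) : R[i] :=
  (plateau l m z.1)%:C * (rsymb L u (level l m) b z.2)%:C.
have half (h g : R) (F : bool -> R) : h * g <= \sum_b F b ->
    exists b, h * (2^-1 * g) <= F b.
  rewrite big_bool => H; apply: contrapT => /forallNP nb.
  have := nb true; have := nb false => /negP + /negP; rewrite -!ltNge.
  by move: (F true) (F false) H => x y /=; nra.
have /choice[b bP] m : exists b, height l m * (2^-1 * gain L k u) <=
    complex.Re (locop (part b m) phi1 phi2 (input (level l m) b (center m))
      (output (level l m) b (center m))).
  apply: half; exact: (locop_test_lower_bound L1 k0 Wu Wu1 Wu2 sw (level l m)
    (plateau_bsupp l m) (height_ge0 l m) (plateau_ge0 l m) (@plateau_near l m)).
have [C CP] := bounded _ (CLfun_gliding_symbol l b).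
(* Boundedness provides [C] without a sign. *)
pose C' := Num.max C 0; have C0 : 0 <= C' by rewrite le_max lexx orbT.
exists (C' * test_const d L M) => m; set n := (l * m)%N.
have loc : locop (fun z => (gliding_symbol l b z)%:C) phi1 phi2
     (input n (b m) (center m)) (output n (b m) (center m)) =
   locop (part (b m) m) phi1 phi2 (input n (b m) (center m)) (output n (b m) (center m)).
  apply: (@eq_locop _ _ _ _ _ _ _ _ (slab (center m) (2 * L) (2 * L))).
    by move=> t x ft nx; exact: (test_in_supp L1 Wu Wu1 ft nx).
  by move=> z zc; rewrite (gliding_symbolE l b zc) /part -rmorphM.
have up : `|complex.Re (locop (part (b m) m) phi1 phi2 (input n (b m) (center m))
     (output n (b m) (center m)))| <=
   C' * (test_const d L M * (2 ^+ n) `^ (2^-1 - loss sw p)).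
  rewrite -loc; apply: (test_upper_bound L1 k0 Wu p1 C0).
  apply: locop_Lnorm_leW (CP _ (CLfun_test_in n (b m) (center m))).
  by apply: lee_wpmul2r; [exact: Lnorm_ge0|rewrite lee_fin le_max lexx].
have := le_trans (bP m) (le_trans (ler_norm _) up).
have N0 : 0 < 2 ^+ n :> R by rewrite exprn_gt0.
rewrite /height -/n.
have P0 : 0 < (2 ^+ n) `^ expo q :> R by rewrite powR_gt0.
have m0 : 0 < 2 ^+ m :> R by rewrite exprn_gt0.
have PV : (2 ^+ n) `^ (- expo q) = ((2 ^+ n) `^ expo q)^-1 :> R by rewrite powRN.
(* Dividing by [height m] puts 2^m N^(1/q) on the right, the form asked by [exponent_ge0]. *)
rewrite /level -/n PV -invfM mulrC ler_pdivrMr ?mulr_gt0// => /le_trans; apply.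
rewrite -powR2.
by rewrite le_eqVlt; apply/orP; left; apply/eqP; ring.
Qed.

End necessary_conditions.
Lemma ge0_complexE (R : realType) (z : R[i]) : 0 <= z ->
  z = (complex.Re z)%:C /\ 0 <= complex.Re z.
Proof. by case: z => x y; rewrite lecE /= => /andP[/eqP -> x0]. Qed.

Lemma Cc_infty_window (R : realType) (d : nat) (phi : 'rV[R]_d.+1 -> R[i]) :
  Cc_infty phi -> phi 0 = 1 -> (forall t, 0 <= phi t) ->
  exists L M k, 0 < k /\ window L M k (fun t => complex.Re (phi t)).
Proof.
move=> [[sphi _] cphi] phi0 phi_ge0; apply: window_exists => //.
- exists (closure [set x | phi x != 0]) => // x nx.
  suff -> : phi x = 0 by [].
  apply/eqP; apply: contrapT => /negP px.
  by apply: nx; exact: subset_closure.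
- by move=> t; have [] := ge0_complexE (phi_ge0 t).
- by rewrite phi0.
Qed.

Theorem corollary6p3 (R : realType) (d : nat)
    (phi1 phi2 : 'rV[R]_d -> R[i]) (q r : \bar R)
    (d_gt0 : (1 <= d)%N)
    (phi1_Cc : Cc_infty phi1) (phi2_Cc : Cc_infty phi2)
    (phi1_0 : phi1 0 = 1) (phi2_0 : phi2 0 = 1)
    (phi1_ge0 : forall t, 0 <= phi1 t) (phi2_ge0 : forall t, 0 <= phi2 t)
    (q_ge1 : (1 <= q)%E) (r_ge1 : (1 <= r)%E)
    (bounded :
      (forall a : 'rV[R]_d * 'rV[R]_d -> R[i],
        CLfun (lebesgue_rV R d \x lebesgue_rV R d)%E q a ->
        locop_bounded r a phi1 phi2)
      \/
      (exists2 C : R, 0 < C &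
        forall (f : 'rV[R]_d -> R[i]) (a : 'rV[R]_d * 'rV[R]_d -> R[i]),
        schwartz f -> schwartz a ->
        locop_Lnorm_le r a phi1 phi2 f
          (C%:E * CLnorm (lebesgue_rV R d \x lebesgue_rV R d) q a
                * CLnorm (lebesgue_rV R d) r f)%E)) :
  (`| r^-1 - 2^-1%R%:E | <= q^-1)%E.
Proof.
case: d => [//|d] in phi1 phi2 d_gt0 phi1_Cc phi2_Cc phi1_0 phi2_0 phi1_ge0 phi2_ge0 bounded *.
have [La [Ma [ka [ka0 Wa]]]] := Cc_infty_window phi1_Cc phi1_0 phi1_ge0.
have [Lb [Mb [kb [kb0 Wb]]]] := Cc_infty_window phi2_Cc phi2_0 phi2_ge0.
pose L := Num.max 1 (Num.max La Lb); pose M := Num.max Ma Mb; pose k := Num.min ka kb.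
have L1 : 1 <= L by rewrite le_max lexx.
have k0 : 0 < k by rewrite lt_min ka0.
have W1 : window L M k (fun t => complex.Re (phi1 t)).
  by apply: window_weaken Wa; rewrite ?le_max ?ge_min ?lexx ?orbT.
have W2 : window L M k (fun t => complex.Re (phi2 t)).
  by apply: window_weaken Wb; rewrite ?le_max ?ge_min ?lexx ?orbT.
(* In the order of [R[i]] nonnegative numbers are real, so the windows are real-valued. *)
have E1 : phi1 = fun t => (complex.Re (phi1 t))%:C.
  by apply/funext => t; have [] := ge0_complexE (phi1_ge0 t).
have E2 : phi2 = fun t => (complex.Re (phi2 t))%:C.
  by apply/funext => t; have [] := ge0_complexE (phi2_ge0 t).
rewrite E1 E2 in bounded.
(* The first window doubles as the bump [u]. The value false gives 1/r <= 1/q + 1/2, the value true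
   gives 1/2 <= 1/q + 1/r. *)
have key sw : 0 <= expo q + (2^-1 - loss sw r).
  case: bounded => [bounded|[C C0 bounded]].
    exact: (bounded_exponent sw L1 k0 W1 W1 W2 r_ge1 q_ge1 bounded).
  exact: (schwartz_bound_exponent sw L1 k0 W1 W1 W2 r_ge1 q_ge1 C0 bounded).
rewrite !expoE// -EFinB abse_EFin lee_fin ler_norml.
have := key true; have := key false; rewrite /loss => k1 k2.
by apply/andP; split; lra.
Qed.
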